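(* Let $\mathbb K$ be a field and let $\mathcal C$ be a fusion category over $\mathbb K$ with endomorphism field $\mathbb E=\operatorname{End}(\mathbf 1_{\mathcal C})$. Then, up to a positive scalar factor, the regular element $\mathcal R$ of the fusion semiring $\mathbb N\mathcal O(\mathcal C)$ is given by $$\mathcal R=\sum_{X\in\mathcal O(\mathcal C)}\frac{\operatorname{FPdim}(X)}{\dim_{\mathbb E}\operatorname{End}(X)}\cdot[X]\ \in\ \mathbb R\otimes_{\mathbb N}\mathbb N\mathcal O(\mathcal C),$$ where the dimension $\dim_{\mathbb E}\operatorname{End}(X)$ is taken with respect to the left embedding $\lambda_X:\mathbb E\hookrightarrow\operatorname{End}(X)$.
   Context: A finite $\mathbb K$-linear abelian category is separable over $\mathbb K$ if it is equivalent to the category of finite-dimensional modules over a finite-dimensional separable $\mathbb K$-algebra $A$ (i.e. the multiplication $A\otimes A\to A$ splits as a map of $A$-bimodules). A fusion category over $\mathbb K$ is a rigid monoidal category $\mathcal C$ that is separable over $\mathbb K$, whose tensor product is $\mathbb K$-linear in both arguments, and whose unit $\mathbf 1$ is simple. It is not assumed that $\operatorname{End}(\mathbf 1)=\mathbb K$ or that $\mathbb K$ is algebraically closed. The ring $\mathbb E=\operatorname{End}(\mathbf 1)$ is a finite field extension of $\mathbb K$, called the endomorphism field. Left embedding: for an object $X$ and $e\in\mathbb E$, $\lambda_X(e)=\ell_X\circ(e\otimes\mathrm{id}_X)\circ\ell_X^{-1}\in\operatorname{End}(X)$, where $\ell_X:\mathbf 1\otimes X\to X$ is the left unitor. $\mathcal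 O(\mathcal C)$ is the finite set of isomorphism classes of simple objects. $\mathbb N\mathcal O(\mathcal C)$ is the free commutative monoid on $\mathcal O(\mathcal C)$; every object $X$ has a class $[X]$ with $[X\oplus Y]=[X]+[Y]$, and it is a semiring via $[X][Y]=[X\otimes Y]$. It is called the fusion semiring of $\mathcal C$. For $a\in\mathbb N\mathcal O(\mathcal C)$, $\operatorname{FPdim}(a)$ is the largest non-negative real eigenvalue (the Frobenius–Perron eigenvalue) of the matrix of left multiplication by $a$ in the basis of simple classes, and $\operatorname{FPdim}(X):=\operatorname{FPdim}([X])$. The regular element is the (unique up to scaling) nonzero element $\mathcal R\in\mathbb R\otimes_{\mathbb N}\mathbb N\mathcal O(\mathcal C)$ such that $x\mathcal R=\operatorname{FPdim}(x)\mathcal R$ for all $x\in\mathbb N\mathcal O(\mathcal C)$, normalized so that all its coefficients are positive. *)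

(* Defs.v *)
From HB Require Import structures.
From mathcomp Require Import all_boot all_order all_algebra falgebra.
From mathcomp Require Import boolp classical_sets reals.
Set Implicit Arguments.
Unset Strict Implicit.
Unset Printing Implicit Defensive.
Import GRing.Theory passmx.
Local Open Scope ring_scope.

Record linear_category (K : fieldType) := LinearCategory {
  object :> Type;
  hom : object -> object -> lmodType K;
  idm : forall X, hom X X;
  comp : forall X Y Z, hom Y Z -> hom X Y -> hom X Z;
  compA : forall X Y Z T (h : hom Z T) (g : hom Y Z) (f : hom X Y),
    comp h (comp g f) = comp (comp h g) f;
  comp1m : forall X Y (f : hom X Y), comp (idm Y) f = f;
  compm1 : forall X Y (f : hom X Y), comp f (idm X) = f;
  comp_linl : forall X Y Z (f : hom X Y), linear (fun g : hom Y Z => comp g f);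
  comp_linr : forall X Y Z (g : hom Y Z), linear (fun f : hom X Y => comp g f)
}.

Arguments hom {K _} X Y.
Arguments idm {K _} X.
Arguments comp {K _ X Y Z} g f.
Notation "g \c f" := (comp g f) (at level 40, left associativity).

Section LinearCategory.
Variables (K : fieldType) (C : linear_category K).
Implicit Types X Y Z P : C.

Record iso X Y := Iso {
  iso_fwd :> hom X Y;
  iso_bwd : hom Y X;
  iso_fwdK : iso_bwd \c iso_fwd = idm X;
  iso_bwdK : iso_fwd \c iso_bwd = idm Y
}.

Definition isomorphic X Y : Prop := inhabited (iso X Y).

Definition is_iso X Y (f : hom X Y) : Prop := exists i : iso X Y, iso_fwd i = f.

Lemma isomorphic_sym X Y : isomorphic X Y -> isomorphic Y X.
Proof. by case=> [[f g gf fg]]; split; exists g f. Qed.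

Lemma isomorphic_trans X Y Z :
  isomorphic X Y -> isomorphic Y Z -> isomorphic X Z.
Proof.
case=> [[f g gf fg]] [[f' g' gf' fg']]; split; exists (f' \c f) (g \c g').
  by rewrite -compA [g' \c _]compA gf' comp1m.
by rewrite -compA [f \c _]compA fg comp1m.
Qed.

Lemma comp_0l X Y Z (f : hom X Y) : (0 : hom Y Z) \c f = 0.
Proof.
by have := comp_linl f (-1) (0 : hom Y Z) 0; rewrite !scaleN1r !addNr.
Qed.

Lemma comp_0r X Y Z (g : hom Y Z) : g \c (0 : hom X Y) = 0.
Proof.
by have := comp_linr g (-1) (0 : hom X Y) 0; rewrite !scaleN1r !addNr.
Qed.

Definition mono X Y (f : hom X Y) : Prop :=
  forall Z (u v : hom Z X), f \c u = f \c v -> u = v.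

Definition epi X Y (f : hom X Y) : Prop :=
  forall Z (u v : hom Y Z), u \c f = v \c f -> u = v.

Definition is_zero X : Prop :=
  forall Y, (forall f : hom X Y, f = 0) /\ (forall g : hom Y X, g = 0).

Definition is_direct_sum X Y Z : Prop :=
  exists (i1 : hom X Z) (i2 : hom Y Z) (p1 : hom Z X) (p2 : hom Z Y),
    [/\ p1 \c i1 = idm X, p2 \c i2 = idm Y, p2 \c i1 = 0, p1 \c i2 = 0
      & i1 \c p1 + i2 \c p2 = idm Z].

Definition is_kernel X Y Z (f : hom Y Z) (k : hom X Y) : Prop :=
  f \c k = 0 /\
  forall T (g : hom T Y), f \c g = 0 -> exists! u : hom T X, k \c u = g.

Definition is_cokernel X Y Z (f : hom X Y) (c : hom Y Z) : Prop :=
  c \c f = 0 /\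
  forall T (g : hom Y T), g \c f = 0 -> exists! u : hom Z T, u \c c = g.

Record is_abelian : Prop := IsAbelian {
  abelian_zero : exists Z, is_zero Z;
  abelian_sum : forall X Y, exists Z, is_direct_sum X Y Z;
  abelian_ker : forall Y Z (f : hom Y Z), exists X (k : hom X Y), is_kernel f k;
  abelian_coker :
    forall X Y (f : hom X Y), exists Z (c : hom Y Z), is_cokernel f c;
  abelian_mono : forall X Y (k : hom X Y), mono k ->
    exists Z (f : hom Y Z), is_kernel f k;
  abelian_epi : forall Y Z (c : hom Y Z), epi c ->
    exists X (f : hom X Y), is_cokernel f c
}.

Definition simple X : Prop :=
  ~ is_zero X /\
  forall Y (i : hom Y X), mono i -> is_zero Y \/ is_iso i.

Inductive finite_length : C -> Prop :=
| FiniteLengthZero X : is_zero X -> finite_length X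
| FiniteLengthExt Y X S (i : hom Y X) (q : hom X S) :
    finite_length Y -> mono i -> is_cokernel i q -> simple S ->
    finite_length X.

Definition projective P : Prop :=
  forall Y Z (e : hom Y Z) (f : hom P Z), epi e ->
    exists g : hom P Y, e \c g = f.

Record is_finite : Prop := IsFinite {
  finite_hom : forall X Y, exists n (b : 'I_n -> hom X Y),
    forall f, exists a : 'I_n -> K, f = \sum_j a j *: b j;
  finite_obj : forall X, finite_length X;
  finite_proj : forall X, exists P (e : hom P X), projective P /\ epi e;
  finite_simple : exists n (S : 'I_n -> C),
    forall X, simple X -> exists j, isomorphic X (S j)
}.

End LinearCategory.

Record linear_functor (K : fieldType) (C D : linear_category K) :=
  LinearFunctor {
  fobj :> C -> D;
  fmap : forall X Y, hom X Y -> hom (fobj X) (fobj Y);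
  fmap_lin : forall X Y, linear (@fmap X Y);
  fmap_id : forall X, fmap (idm X) = idm (fobj X);
  fmap_comp : forall X Y Z (g : hom Y Z) (f : hom X Y),
    fmap (g \c f) = fmap g \c fmap f
}.

Definition equivalent (K : fieldType) (C D : linear_category K) : Prop :=
  exists (F : linear_functor C D) (G : linear_functor D C)
         (eta : forall X : C, iso (G (F X)) X)
         (eps : forall Y : D, iso (F (G Y)) Y),
    (forall X Y (f : hom X Y), f \c eta X = eta Y \c fmap G (fmap F f)) /\
    (forall X Y (f : hom X Y), f \c eps X = eps Y \c fmap F (fmap G f)).

(* [falgType K] consists of the nonzero finite-dimensional algebras; the zero
   algebra, whose only module is 0, never gives a category with a simple
   object. *)
Section ModuleCategory.
Variables (K : fieldType) (A : falgType K).

Record fd_module := FdModule {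
  fd_carrier :> vectType K;
  act : A -> 'End(fd_carrier);
  act_lin : linear act;
  act1 : act 1 = \1%VF;
  actM : forall a b, act (a * b) = (act a \o act b)%VF
}.

Arguments act : clear implicits.

Definition equivariant (M N : fd_module) : {pred 'Hom(M, N)} :=
  fun f => `[< forall a, (f \o act M a)%VF = (act N a \o f)%VF >].

Arguments equivariant : clear implicits.

Lemma equivariantP (M N : fd_module) (f : 'Hom(M, N)) :
  reflect (forall a, (f \o act M a)%VF = (act N a \o f)%VF)
          (f \in equivariant M N).
Proof. exact: asboolP. Qed.

Lemma equivariant_submod (M N : fd_module) : submod_closed (equivariant M N).
Proof.
split=> [|k f g /equivariantP fP /equivariantP gP]; apply/equivariantP => a.
  by rewrite comp_lfun0l comp_lfun0r.
by rewrite comp_lfunDl comp_lfunDr -comp_lfunZl -comp_lfunZr fP gP.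
Qed.

HB.instance Definition _ (M N : fd_module) :=
  GRing.isSubmodClosed.Build K 'Hom(M, N) (equivariant M N)
    (equivariant_submod M N).

Record fd_hom (M N : fd_module) := FdHom {
  fd_fun :> 'Hom(M, N);
  fd_funP : fd_fun \in equivariant M N
}.

HB.instance Definition _ M N := [isSub for @fd_fun M N].
HB.instance Definition _ M N := [Choice of fd_hom M N by <:].
HB.instance Definition _ M N :=
  [SubChoice_isSubLmodule of fd_hom M N by <:].

Lemma fd_id_subproof (M : fd_module) : \1%VF \in equivariant M M.
Proof. by apply/equivariantP => a; rewrite comp_lfun1l comp_lfun1r. Qed.

Definition fd_id (M : fd_module) : fd_hom M M := FdHom (fd_id_subproof M).

Lemma fd_comp_subproof (M N P : fd_module) (g : fd_hom N P) (f : fd_hom M N) :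
  (fd_fun g \o fd_fun f)%VF \in equivariant M P.
Proof.
apply/equivariantP => a.
rewrite -comp_lfunA (equivariantP _ (fd_funP f)) !comp_lfunA.
by rewrite (equivariantP _ (fd_funP g)).
Qed.

Definition fd_comp (M N P : fd_module) (g : fd_hom N P) (f : fd_hom M N) :
  fd_hom M P := FdHom (fd_comp_subproof g f).

Lemma fd_compA M N P Q (h : fd_hom P Q) (g : fd_hom N P) (f : fd_hom M N) :
  fd_comp h (fd_comp g f) = fd_comp (fd_comp h g) f.
Proof. by apply: val_inj; rewrite /= comp_lfunA. Qed.

Lemma fd_comp1m M N (f : fd_hom M N) : fd_comp (fd_id N) f = f.
Proof. by apply: val_inj; rewrite /= comp_lfun1l. Qed.

Lemma fd_compm1 M N (f : fd_hom M N) : fd_comp f (fd_id M) = f.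
Proof. by apply: val_inj; rewrite /= comp_lfun1r. Qed.

Lemma fd_comp_linl M N P (f : fd_hom M N) :
  linear (fun g : fd_hom N P => fd_comp g f).
Proof.
by move=> k g h; apply: val_inj; rewrite /= comp_lfunDl -comp_lfunZl.
Qed.

Lemma fd_comp_linr M N P (g : fd_hom N P) :
  linear (fun f : fd_hom M N => fd_comp g f).
Proof.
by move=> k f h; apply: val_inj; rewrite /= comp_lfunDr -comp_lfunZr.
Qed.

Definition module_category : linear_category K :=
  LinearCategory fd_compA fd_comp1m fd_compm1 fd_comp_linl fd_comp_linr.

End ModuleCategory.

(* A (x) A is modelled by the square matrices of size \dim A: in coordinates
   with respect to a basis e of A, the matrix M stands for
   \sum_(i, j) M i j (e_i (x) e_j). *)
Section SeparableAlgebra.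
Variables (K : fieldType) (A : falgType K).

Let d := \dim {:A}.
Let e : d.-tuple A := vbasis {:A}.

Definition tensor_square := 'M[K]_d.

Definition pure_tensor (x y : A) : tensor_square := (rVof e x)^T *m rVof e y.

Definition lmul_mx (a : A) : 'M[K]_d := mxof e e (amull a).
Definition rmul_mx (b : A) : 'M[K]_d := mxof e e (amulr b).

Definition bimod_act (a b : A) (M : tensor_square) : tensor_square :=
  (lmul_mx a)^T *m M *m rmul_mx b.

Definition mult (M : tensor_square) : A :=
  \sum_i \sum_j M i j *: (e`_i * e`_j).

Definition separable_algebra : Prop :=
  exists s : A -> tensor_square,
    [/\ linear s,
        forall a x b, s (a * x * b) = bimod_act a b (s x)
      & forall x, mult (s x) = x].

Let e_basis : basis_of {:A} e. Proof. exact: vbasisP. Qed.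

Lemma tensor_squareE (M : tensor_square) :
  M = \sum_i \sum_j M i j *: pure_tensor e`_i e`_j.
Proof.
rewrite {1}(matrix_sum_delta M); apply: eq_bigr => i _; apply: eq_bigr => j _.
by rewrite /pure_tensor !rVofE // trmx_delta mul_delta_mx.
Qed.

Lemma bimod_act_pure a b x y :
  bimod_act a b (pure_tensor x y) = pure_tensor (a * x) (y * b).
Proof.
have lmulE : rVof e x *m lmul_mx a = rVof e (a * x).
  by rewrite mul_mxof rVofK // lfunE.
have rmulE : rVof e y *m rmul_mx b = rVof e (y * b).
  by rewrite mul_mxof rVofK // lfunE.
by rewrite /bimod_act /pure_tensor !mulmxA -trmx_mul lmulE -mulmxA rmulE.
Qed.

Lemma mult_pure x y : mult (pure_tensor x y) = x * y.
Proof.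
rewrite -[x in RHS](rVofK e_basis) -[y in RHS](rVofK e_basis) /vecof mulr_suml.
apply: eq_bigr => i _; rewrite mulr_sumr; apply: eq_bigr => j _.
by rewrite /pure_tensor !mxE big_ord1 !mxE -scalerAl -scalerAr scalerA.
Qed.

End SeparableAlgebra.

Definition is_separable (K : fieldType) (C : linear_category K) : Prop :=
  [/\ is_abelian C, is_finite C
    & exists A : falgType K,
        separable_algebra A /\ equivalent C (module_category A)].

Record monoidal (K : fieldType) (C : linear_category K) := Monoidal {
  tens : C -> C -> C;
  tensm : forall X X' Y Y' : C,
    hom X X' -> hom Y Y' -> hom (tens X Y) (tens X' Y');
  tensm_id : forall X Y, tensm (idm X) (idm Y) = idm (tens X Y);
  tensm_comp : forall X X' X'' Y Y' Y''
    (f' : hom X' X'') (f : hom X X') (g' : hom Y' Y'') (g : hom Y Y'),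
    tensm (f' \c f) (g' \c g) = tensm f' g' \c tensm f g;
  unit_obj : C;
  assoc : forall X Y Z, iso (tens (tens X Y) Z) (tens X (tens Y Z));
  lunit : forall X, iso (tens unit_obj X) X;
  runit : forall X, iso (tens X unit_obj) X;
  assoc_nat : forall X X' Y Y' Z Z'
    (f : hom X X') (g : hom Y Y') (h : hom Z Z'),
    assoc X' Y' Z' \c tensm (tensm f g) h
      = tensm f (tensm g h) \c assoc X Y Z;
  lunit_nat : forall X X' (f : hom X X'),
    lunit X' \c tensm (idm unit_obj) f = f \c lunit X;
  runit_nat : forall X X' (f : hom X X'),
    runit X' \c tensm f (idm unit_obj) = f \c runit X;
  pentagon : forall W X Y Z,
    assoc W X (tens Y Z) \c assoc (tens W X) Y Z
      = tensm (idm W) (assoc X Y Z) \c assoc W (tens X Y) Z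
          \c tensm (assoc W X Y) (idm Z);
  triangle : forall X Y,
    tensm (idm X) (lunit Y) \c assoc X unit_obj Y
      = tensm (runit X) (idm Y)
}.

Section Monoidal.
Variables (K : fieldType) (C : linear_category K) (T : monoidal C).
Implicit Types X Y : C.

Definition tensor_bilinear : Prop :=
  forall X X' Y Y' : C,
    (forall g : hom Y Y', linear (fun f : hom X X' => tensm T f g)) /\
    (forall f : hom X X', linear (fun g : hom Y Y' => tensm T f g)).

(* D is a left dual of X, and X a right dual of D. *)
Definition is_left_dual D X : Prop :=
  exists (ev : hom (tens T D X) (unit_obj T))
         (coev : hom (unit_obj T) (tens T X D)),
    runit T X \c tensm T (idm X) ev \c assoc T X D X
      \c tensm T coev (idm X) \c iso_bwd (lunit T X) = idm X /\
    lunit T D \c tensm T ev (idm D) \c iso_bwd (assoc T D X D)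
      \c tensm T (idm D) coev \c iso_bwd (runit T D) = idm D.

Definition rigid : Prop :=
  forall X, (exists D, is_left_dual D X) /\ (exists D, is_left_dual X D).

End Monoidal.

Record fusion_category (K : fieldType) := FusionCategory {
  fusion_cat :> linear_category K;
  fusion_mon : monoidal fusion_cat;
  fusion_rigid : rigid fusion_mon;
  fusion_sep : is_separable fusion_cat;
  fusion_bilinear : tensor_bilinear fusion_mon;
  fusion_unit : simple (unit_obj fusion_mon)
}.

(* The finite set of isomorphism classes of simple objects, given by a complete
   and irredundant family of representatives.  The classes themselves, as
   predicates on objects, live in too large a universe to form a [finType]. *)
Record simple_classes (K : fieldType) (C : linear_category K) := SimpleClasses {
  class_index :> finType;
  simple_repr : class_index -> C;
  simple_reprP : forall i, simple (simple_repr i);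
  simple_repr_inj : forall i j,
    isomorphic (simple_repr i) (simple_repr j) -> i = j;
  simple_repr_surj : forall X, simple X ->
    exists i, isomorphic X (simple_repr i)
}.

Lemma simple_iso (K : fieldType) (C : linear_category K) (X Y : C) :
  isomorphic X Y -> simple X -> simple Y.
Proof.
case=> [[f g gf fg]] [nz sub]; split=> [zY | Z i mi].
  apply: nz => Z; split=> h.
    by rewrite -[h]compm1 -gf compA ((zY Z).1 (h \c g)) comp_0l.
  by rewrite -[h]comp1m -gf -compA ((zY Z).2 (f \c h)) comp_0r.
have iE : i = f \c (g \c i) by rewrite compA fg comp1m.
have gi_mono : mono (g \c i).
  by move=> T u v uv; apply: mi; rewrite iE -!(compA f) uv.
case: (sub Z _ gi_mono) => [zZ | [[h k kh hk] /= hE]]; [by left | right].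
have ghE : f \c h = i by rewrite hE -iE.
have kgE : (k \c g) \c i = idm Z by rewrite -compA -hE.
have ikg : i \c (k \c g) = idm Y by rewrite -ghE -compA [h \c _]compA hk comp1m.
by exists (Iso kgE ikg).
Qed.

Lemma simple_classes_exist (K : fieldType) (C : linear_category K) :
  is_finite C -> inhabited (simple_classes C).
Proof.
case=> _ _ _ [n [S surjS]].
pose first (j : 'I_n) := `[< simple (S j) /\
  forall i : 'I_n, isomorphic (S i) (S j) -> (j <= i)%N >].
have firstP (j : {j | first j}) : simple (S (val j)).
  by have /asboolP[] := valP j.
have first_inj (i j : {j | first j}) :
  isomorphic (S (val i)) (S (val j)) -> i = j.
  move=> ij; apply/val_inj/val_inj/eqP; rewrite eqn_leq.
  have /asboolP[_ mini] := valP i; have /asboolP[_ minj] := valP j.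
  by rewrite mini ?minj //; exact: isomorphic_sym.
have first_surj X : simple X ->
  exists j : {j | first j}, isomorphic X (S (val j)).
  move=> sX; have [k Xk] := surjS X sX.
  pose P (i : 'I_n) := `[< isomorphic X (S i) >].
  have Pk : P k by exact/asboolP.
  case: (arg_minnP (fun i : 'I_n => i : nat) Pk) => j /asboolP Xj minj.
  have fj : first j.
    apply/asboolP; split=> [|i ij]; first exact: simple_iso sX.
    by apply/minj/asboolP/(isomorphic_trans Xj)/isomorphic_sym.
  by exists (exist _ j fj).
by constructor; exists {j | first j} (fun j => S (val j)).
Qed.

Section FusionSemiring.
Variables (K : fieldType) (C : fusion_category K) (O : simple_classes C).

(* For S = nat this is the free commutative monoid on O, and
   for S = R its extension of scalars from nat to R. *)
Definition fusion_module (S : nzSemiRingType) := {ffun O -> S}.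

Definition basis_elt (S : nzSemiRingType) (i : O) :
  fusion_module S := [ffun j => (i == j)%:R].

Inductive has_class : C -> fusion_module nat -> Prop :=
| HasClassZero X : is_zero X -> has_class X 0
| HasClassSimple (i : O) X : isomorphic X (simple_repr i) ->
    has_class X (basis_elt nat i)
| HasClassSum X Y Z a b : has_class X a -> has_class Y b ->
    is_direct_sum X Y Z -> has_class Z (a + b).

(* Every object of a fusion category has exactly one class, so the default
   value 0 is never used (and likewise for [FPdim] and [endo_dim] below). *)
Definition obj_class (X : C) : fusion_module nat :=
  xget 0 [set a | has_class X a]%classic.

Definition fusion_scale (S : nzSemiRingType) (s : S) (a : fusion_module S) :
  fusion_module S := [ffun k => s * a k].

(* The bilinear extension of [X_i][X_j] = [X_i (x) X_j]. *)
Definition fusion_mul (S : nzSemiRingType) (a b : fusion_module S) :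
  fusion_module S :=
  [ffun k => \sum_i \sum_j
     a i * b j *
     (obj_class (tens (fusion_mon C) (simple_repr i) (simple_repr j)) k)%:R].

Definition scal_ext (S : nzSemiRingType) (a : fusion_module nat) :
  fusion_module S := [ffun k => (a k)%:R].

Variable R : realType.

(* Acts on row vectors of coordinates, as [eigenvalue] expects: row j holds the
   coordinates of the product of a with the j-th basis element. *)
Definition lmult_matrix (a : fusion_module nat) : 'M[R]_#|O| :=
  \matrix_(j, k)
    fusion_mul (scal_ext R a) (basis_elt R (enum_val j)) (enum_val k).

Definition FPdim (a : fusion_module nat) : R :=
  xget 0 [set r : R | [/\ 0 <= r, eigenvalue (lmult_matrix a) r
    & forall s, 0 <= s -> eigenvalue (lmult_matrix a) s -> s <= r]]%classic.

Definition FPdim_obj (X : C) : R := FPdim (obj_class X).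

Definition regular_element (r : fusion_module R) : Prop :=
  [/\ r != 0,
      forall a : fusion_module nat,
        fusion_mul (scal_ext R a) r = fusion_scale (FPdim a) r
    & forall k, 0 < r k].

End FusionSemiring.

Section EndomorphismField.
Variables (K : fieldType) (C : fusion_category K).
Let T := fusion_mon C.

Definition endo_field := hom (unit_obj T) (unit_obj T).

Definition left_embedding (X : C) (e : endo_field) : hom X X :=
  lunit T X \c tensm T e (idm X) \c iso_bwd (lunit T X).

(* b is a basis of End(X) as a left vector space over End(1) acting through
   the left embedding. *)
Definition is_endo_basis (X : C) n (b : 'I_n -> hom X X) : Prop :=
  forall f : hom X X, exists! e : {ffun 'I_n -> endo_field},
    f = \sum_j left_embedding X (e j) \c b j.

Definition endo_dim (X : C) : nat :=
  xget 0%N [set n | exists b : 'I_n -> hom X X, is_endo_basis b]%classic.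

End EndomorphismField.

(* Main.v *)
(* Let d_k be the dimension over K of End(X_k); it is dim_E End(X_k) times the
   dimension of E.  In a semisimple category dim Hom(X_k, Y) = [Y : X_k] d_k
   = dim Hom(Y, X_k), so a left dual D of X_i gives
     [X_i (x) X_j : X_k] d_k = dim Hom(X_k, X_i (x) X_j)
       = dim Hom(D (x) X_k, X_j) = [D (x) X_k : X_j] d_j.
   Hence the coefficient of [X_k] in [X_i] sum_j FPdim(X_j) / d_j [X_j] is
   FPdim(D (x) X_k) / d_k = FPdim(D) FPdim(X_k) / d_k, and a positive vector
   with this property forces FPdim(D) = FPdim(X_i).  Multiplicativity and
   positivity of FPdim come from a common positive eigenvector of all left
   multiplications: the Perron vector of right multiplication by the sum of the
   simple classes, a matrix with positive entries which commutes with them. *)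
From HB Require Import structures.
From mathcomp Require Import all_boot all_order all_algebra falgebra.
From mathcomp Require Import boolp classical_sets set_interval reals.
From mathcomp Require Import topology normedtype derive.
Require Import Defs.
Set Implicit Arguments.
Unset Strict Implicit.
Unset Printing Implicit Defensive.
Import Order.TTheory GRing.Theory Num.Theory numFieldNormedType.Exports passmx.
Local Open Scope ring_scope.

(** * Dimension of vector spaces *)

(** Separability only gives an equivalence with a module category, whereas counting Hom dimensions
    needs split extensions in [C] itself. The bridge is von Neumann regularity: every f admits some
    g with f g f = f. Being an equation, it passes along an equivalence without any transport of
    kernels or simple objects; for a monomorphism it gives a retraction, so that finite length
    becomes a direct sum of simple objects. Dimensions are counted over K rather than over E because
    duality exchanges the left and the right action of E on Hom spaces, while everything in sight is
    K-linear; the common factor dim_K E is cancelled at the end. Since only dimensions enter, the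
    adjunction between X (x) - and D (x) - is replaced by two injective linear maps, hence two
    inequalities. All properties of [FPdim] go through one criterion: the eigenvalue of a strictly
    positive eigenvector of left multiplication by a is [FPdim] of a. *)

Definition has_dim (K : fieldType) (V : lmodType K) (n : nat) : Prop :=
  exists f : 'rV[K]_n -> V, linear f /\ bijective f.

Section Dimension.
Variable K : fieldType.
Implicit Types V W : lmodType K.

Lemma can2_linear_for V W (f : V -> W) (g : W -> V) :
  linear f -> cancel f g -> cancel g f -> linear g.
Proof.
by move=> lf fK gK a u v; apply: (can_inj fK); rewrite lf !gK.
Qed.

(** In coordinates an injective map is a matrix of full row rank, and the rank is bounded by the
    number of columns. *)
Lemma has_dim_leq V W m n (g : V -> W) :
  has_dim V m -> has_dim W n -> linear g -> injective g -> (m <= n)%N.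
Proof.
move=> [f [lf [f' fK f'K]]] [h [lh [h' hK h'K]]] lg ig.
have lh' := can2_linear_for lh hK h'K.
pose F := [fun v : 'rV[K]_m => h' (g (f v))].
have lF : linear F by move=> a u v; rewrite /= lf lg lh'.
pose FL : {linear 'rV[K]_m -> 'rV[K]_n} :=
  HB.pack (F : _ -> _) (GRing.isLinear.Build K _ _ _ F lF).
have iF : injective F.
  by move=> u v /(can_inj h'K) /ig /(can_inj fK).
have /eqP <- : row_free (lin1_mx FL).
  apply: inj_row_free => v; rewrite mul_rV_lin1 => Fv0.
  by apply: iF; rewrite [LHS]Fv0 -(linear0 FL).
exact: rank_leq_col.
Qed.

Lemma has_dim_uniq V m n : has_dim V m -> has_dim V n -> m = n.
Proof.
have le p q : has_dim V p -> has_dim V q -> (p <= q)%N.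
  by move=> Vp Vq; apply: (has_dim_leq (g := id) Vp Vq).
by move=> Vm Vn; apply/eqP; rewrite eqn_leq !le.
Qed.

Lemma has_dim0 V : (forall v : V, v = 0) -> has_dim V 0.
Proof.
move=> V0; exists (fun=> 0); split.
  by move=> a u v; rewrite scaler0 addr0.
by exists (fun=> 0) => v; [apply/rowP; case | exact/esym/V0].
Qed.

Lemma has_dim_prod V W (U : lmodType K) m n (f : V -> W -> U) :
  (forall a v v' w w',
     f (a *: v + v') (a *: w + w') = a *: f v w + f v' w') ->
  (exists g : U -> V * W, cancel g (fun p => f p.1 p.2) /\
     cancel (fun p => f p.1 p.2) g) ->
  has_dim V m -> has_dim W n -> has_dim U (m + n).
Proof.
move=> lf [g [gK fK]] [h [lh [h' hK h'K]]] [k [lk [k' kK k'K]]].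
exists (fun v => f (h (lsubmx v)) (k (rsubmx v))); split.
  by move=> a u v; rewrite !linearP lh lk lf.
exists (fun u => row_mx (h' (g u).1) (k' (g u).2)) => [v | u].
  by rewrite (fK (_, _)) /= hK kK hsubmxK.
by rewrite row_mxKl row_mxKr h'K k'K gK.
Qed.

End Dimension.

(* [act] is a scalar action of a division ring on V; it is not bundled, because
   it is used both for K itself and for the left action of End(1). *)
Lemma division_basis (E V : zmodType) (act : E -> V -> V) (one : E)
    (mul : E -> E -> E) :
  (forall e e' v, act (e + e') v = act e v + act e' v) ->
  (forall e v v', act e (v + v') = act e v + act e v') ->
  (forall v, act one v = v) ->
  (forall e e' v, act (mul e e') v = act e (act e' v)) ->
  (forall e, e != 0 -> exists e', mul e' e = one) ->
  (exists n (b : 'I_n -> V), forall v,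
     exists c : 'I_n -> E, v = \sum_j act (c j) (b j)) ->
  exists n (b : 'I_n -> V), forall v,
    exists! c : {ffun 'I_n -> E}, v = \sum_j act (c j) (b j).
Proof.
move=> actDl actDr act1 actM actV spanV.
have act0l v : act 0 v = 0.
  by apply: (addIr (act 0 v)); rewrite -actDl !add0r.
have act0r e : act e 0 = 0.
  by apply: (addIr (act e 0)); rewrite -actDr !add0r.
have actNl e v : act (- e) v = - act e v.
  by apply: (addIr (act e v)); rewrite -actDl !addNr.
have actNr e v : act e (- v) = - act e v.
  by apply: (addIr (act e v)); rewrite -actDr !addNr.
have act_sumr e I (r : seq I) (F : I -> V) :
  act e (\sum_(i <- r) F i) = \sum_(i <- r) act e (F i).
  by elim/big_rec2: _ => // i x y _ <-; rewrite actDr.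
pose P n := `[< exists b : 'I_n -> V, forall v,
  exists c : 'I_n -> E, v = \sum_j act (c j) (b j) >].
have exP : exists n, P n by case: spanV => n ?; exists n; apply/asboolP.
case: (ex_minnP exP) => n /asboolP[b bP] n_min; exists n, b => v.
(* A spanning family of minimal length is free: a relation with a nonzero, hence invertible,
   coefficient at [i] expresses [b i] through the others, and dropping it leaves a shorter spanning
   family. *)
have free (c : 'I_n -> E) : \sum_j act (c j) (b j) = 0 -> forall i, c i = 0.
  move=> c0 i; apply/eqP/negPn/negP => ci0.
  have [e eK] := actV _ ci0; case: n => [|n] in b bP n_min c c0 i ci0 eK *.
    by case: i ci0 eK.
  suff : P n by move/n_min; rewrite ltnn.
  apply/asboolP; exists (fun j => b (lift i j)) => w.
  have [d ->] := bP w.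
  have bi : b i = - \sum_j act (mul e (c (lift i j))) (b (lift i j)).
    apply/eqP; rewrite -addr_eq0 -{1}[b i]act1 -eK actM.
    move: (congr1 (act e) c0); rewrite (bigD1_ord i) //= actDr act_sumr act0r.
    by move/eqP; congr (_ + _ == _); apply: eq_bigr => j _; rewrite actM.
  exists (fun j => d (lift i j) - mul (d i) (mul e (c (lift i j)))).
  rewrite (bigD1_ord i) //= {1}bi actNr act_sumr addrC -sumrN -big_split /=.
  by apply: eq_bigr => j _; rewrite actDl actNl !actM.
have [c vE] := bP v; exists (finfun c); split=> [|c' vE'].
  by rewrite {1}vE; apply: eq_bigr => j _; rewrite ffunE.
apply/ffunP => i; rewrite ffunE; apply/eqP; rewrite -subr_eq0; apply/eqP.
apply: (free (fun i => c i - c' i)) => {i}.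
have -> : \sum_j act (c j - c' j) (b j)
  = \sum_j act (c j) (b j) - \sum_j act (c' j) (b j).
  by rewrite -sumrB; apply: eq_bigr => j _; rewrite actDl actNl.
by rewrite -vE -vE' subrr.
Qed.

Lemma has_dim_basis (K : fieldType) (V : lmodType K) n (b : 'I_n -> V) :
  (forall v, exists! c : {ffun 'I_n -> K}, v = \sum_j c j *: b j) ->
  has_dim V n.
Proof.
move=> bP; exists (fun c => \sum_j c 0 j *: b j); split=> [a u v|].
  rewrite scaler_sumr -big_split /=; apply: eq_bigr => j _.
  by rewrite !mxE scalerDl scalerA.
pose g v : 'rV[K]_n := \row_j (sval (cid (bP v))) j.
have gP v : v = \sum_j g v 0 j *: b j.
  apply: etrans (proj1 (svalP (cid (bP v)))) _.
  by apply: eq_bigr => j _; rewrite mxE.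
exists g => // c; apply/rowP => j; rewrite mxE.
case: cid => d /= [_ /(_ [ffun j => c 0 j]) dP].
by rewrite dP ?ffunE //; apply: eq_bigr => i _; rewrite ffunE.
Qed.

Lemma has_dim_exists (K : fieldType) (V : lmodType K) :
  (exists n (b : 'I_n -> V), forall v,
     exists c : 'I_n -> K, v = \sum_j c j *: b j) ->
  exists n, has_dim V n.
Proof.
move=> spanV; have [||||| n [b bP]] :=
  @division_basis K V *:%R 1 *%R _ _ _ _ _ spanV.
- by move=> e e' v; rewrite scalerDl.
- by move=> e v v'; rewrite scalerDr.
- exact: scale1r.
- by move=> e e' v; rewrite scalerA.
- by move=> e e0; exists e^-1; rewrite mulVf.
by exists n; apply: has_dim_basis bP.
Qed.

(** Coordinates over K form an n by m matrix, flattened by [mxvec]: row j holds the K-coordinates of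
    the j-th E-coefficient. *)
Lemma has_dim_tower (K : fieldType) (E V : lmodType K) (act : E -> V -> V) n
    (b : 'I_n -> V) m :
  (forall v, linear (act^~ v)) ->
  (forall v, exists! c : {ffun 'I_n -> E}, v = \sum_j act (c j) (b j)) ->
  has_dim E m -> has_dim V (n * m).
Proof.
move=> lact bP [f [lf [f' fK f'K]]].
exists (fun v => \sum_j act (f (row j (vec_mx v))) (b j)); split=> [a u v|].
  rewrite scaler_sumr -big_split /=; apply: eq_bigr => j _.
  by rewrite !linearP lf lact.
pose g v : {ffun 'I_n -> E} := sval (cid (bP v)).
have gP v : v = \sum_j act (g v j) (b j) := proj1 (svalP (cid (bP v))).
exists (fun v => mxvec (\matrix_j f' (g v j))) => [c | v].
  rewrite -[RHS]vec_mxK; congr mxvec; apply/row_matrixP => j; rewrite rowK.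
  rewrite /g; case: cid => d /=.
  case=> _ /(_ [ffun j => f (row j (vec_mx c))]) ->; first by rewrite ffunE fK.
  by apply: eq_bigr => i _; rewrite ffunE.
rewrite [RHS]gP; apply: eq_bigr => j _.
by rewrite mxvecK rowK f'K.
Qed.

(** * Semisimplicity *)

(** An equational form of semisimplicity: cancelling a monomorphism f in f g f = f leaves g f = 1,
    so every monomorphism splits, and dually every epimorphism. *)
Definition von_neumann_regular (K : fieldType) (C : linear_category K) : Prop :=
  forall (X Y : C) (f : hom X Y), exists g : hom Y X, f \c g \c f = f.

Section CompLfunSum.
Variables (K : fieldType) (aT vT rT : vectType K) (I : Type) (r : seq I).

Lemma comp_lfun_suml (F : I -> 'Hom(vT, rT)) (g : 'Hom(aT, vT)) :
  ((\sum_(i <- r) F i) \o g = \sum_(i <- r) (F i \o g))%VF.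
Proof.
by elim/big_rec2: _ => [|i _ x _ <-]; rewrite ?comp_lfun0l ?comp_lfunDl.
Qed.

Lemma comp_lfun_sumr (f : 'Hom(vT, rT)) (F : I -> 'Hom(aT, vT)) :
  (f \o (\sum_(i <- r) F i) = \sum_(i <- r) (f \o F i))%VF.
Proof.
by elim/big_rec2: _ => [|i _ x _ <-]; rewrite ?comp_lfun0r ?comp_lfunDr.
Qed.

End CompLfunSum.

(** * Modules over a separable algebra *)

Section SeparableRegular.
Variables (K : fieldType) (A : falgType K).
Let d := \dim {:A}.
Let e : d.-tuple A := vbasis {:A}.

(** The linear extension of x (x) y |-> x s y, written in the coordinates that model A (x) A. *)
Definition sandwich (M N : fd_module A) (s : 'Hom(N, M)) (T : tensor_square A) :
  'Hom(N, M) :=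
  \sum_i \sum_j T i j *: (act M e`_i \o s \o act N e`_j)%VF.

Lemma actD (M : fd_module A) a b : act M (a + b) = act M a + act M b.
Proof. by have := act_lin M 1 a b; rewrite !scale1r. Qed.

Lemma act_sum (M : fd_module A) (I : Type) (r : seq I) (c : I -> K)
    (x : I -> A) :
  act M (\sum_(i <- r) c i *: x i) = \sum_(i <- r) c i *: act M (x i).
Proof.
elim: r => [|i r IH]; last by rewrite !big_cons act_lin IH.
rewrite !big_nil; apply: (addIr (act M 0)).
by rewrite -actD !add0r.
Qed.

Lemma sandwich_linear M N s : linear (@sandwich M N s).
Proof.
move=> k T U; rewrite scaler_sumr -big_split /=; apply: eq_bigr => i _.
rewrite scaler_sumr -big_split /=; apply: eq_bigr => j _.
by rewrite !mxE scalerDl scalerA.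
Qed.

Lemma sandwich_sum M N s (I : finType) (c : I -> K) (T : I -> tensor_square A) :
  @sandwich M N s (\sum_i c i *: T i) = \sum_i c i *: sandwich s (T i).
Proof.
pose F : {linear tensor_square A -> 'Hom(N, M)} := HB.pack (@sandwich M N s)
   (GRing.isLinear.Build K _ _ _ (@sandwich M N s) (@sandwich_linear M N s)).
rewrite -[LHS]/(F _) linear_sum; apply: eq_bigr => i _.
by rewrite linearZ.
Qed.

Lemma sandwich_pure M N s x y :
  @sandwich M N s (pure_tensor x y) = (act M x \o s \o act N y)%VF.
Proof.
have eP := vbasisP {:A}.
rewrite -[x in RHS](rVofK eP) -[y in RHS](rVofK eP) /vecof !act_sum.
rewrite !comp_lfun_suml; apply: eq_bigr => i _.
rewrite comp_lfun_sumr; apply: eq_bigr => j _.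
by rewrite /pure_tensor !mxE big_ord1 !mxE -!comp_lfunZl -comp_lfunZr scalerA.
Qed.

Lemma sandwich_bimod M N s a b T :
  @sandwich M N s (bimod_act a b T)
  = (act M a \o sandwich s T \o act N b)%VF.
Proof.
rewrite [T in LHS]tensor_squareE [T in RHS]tensor_squareE.
have -> : bimod_act a b
    (\sum_i \sum_j T i j *: pure_tensor e`_i e`_j)
  = \sum_i \sum_j T i j *: pure_tensor (a * e`_i) (e`_j * b).
  rewrite /bimod_act mulmx_sumr mulmx_suml; apply: eq_bigr => i _.
  rewrite mulmx_sumr mulmx_suml; apply: eq_bigr => j _.
  by rewrite -scalemxAr -scalemxAl -bimod_act_pure.
(* The inner sums get the coefficient 1 so that [sandwich_sum] also applies to the outer sum. *)
under eq_bigr => i _ do rewrite -[\sum_j _]scale1r.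
under [in RHS]eq_bigr => i _ do rewrite -[\sum_j _]scale1r.
rewrite !sandwich_sum comp_lfun_sumr comp_lfun_suml; apply: eq_bigr => i _.
rewrite !scale1r !sandwich_sum comp_lfun_sumr comp_lfun_suml.
apply: eq_bigr => j _.
by rewrite -comp_lfunZr -comp_lfunZl !sandwich_pure !actM !comp_lfunA.
Qed.

(* Averaging a K-linear generalized inverse of f over the separability
   idempotent gives an A-linear one. *)
Lemma module_category_regular :
  separable_algebra A -> von_neumann_regular (module_category A).
Proof.
case=> s [_ s_bimod sK] M N f; pose T := s 1.
(* [T] is the separability element; a T and T a both equal s(a). *)
have Tcomm a : bimod_act a 1 T = bimod_act 1 a T.
  by rewrite -!s_bimod !mulr1 !mul1r.
pose g := sandwich (fd_fun f)^-1%VF T.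
have gP : g \in equivariant (M := N) (N := M).
  apply/equivariantP => a; rewrite /g.
  have := congr1 (sandwich (M := M) (N := N) (fd_fun f)^-1%VF) (Tcomm a).
  by rewrite !sandwich_bimod !act1 comp_lfun1l comp_lfun1r => ->.
exists (FdHom gP); apply: val_inj => /=.
have fKf : (fd_fun f \o (fd_fun f)^-1 \o fd_fun f)%VF = fd_fun f.
  by apply/lfunP => v; rewrite !comp_lfunE limg_lfunVK // memv_img ?memvf.
have fA a : (fd_fun f \o act M a)%VF = (act N a \o fd_fun f)%VF.
  exact: (equivariantP _ (fd_funP f)).
(* Moving f across the actions turns each term f e_i f^-1 e_j f into e_i (f f^-1 f) e_j = e_i e_j f;
   the sum is then mult(T) f = f. *)
rewrite /g comp_lfun_sumr comp_lfun_suml.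
transitivity (act N (mult T) \o fd_fun f)%VF; last first.
  by rewrite sK act1 comp_lfun1l.
rewrite /mult.
under [in RHS]eq_bigr => i _ do rewrite -[\sum_j _]scale1r.
rewrite act_sum comp_lfun_suml; apply: eq_bigr => i _.
rewrite scale1r act_sum comp_lfun_sumr !comp_lfun_suml.
apply: eq_bigr => j _.
rewrite -comp_lfunZr -!comp_lfunZl actM !comp_lfunA fA.
rewrite -!comp_lfunA -fA.
by rewrite [X in (_ \o X)%VF]comp_lfunA [X in (_ \o X)%VF]comp_lfunA fKf fA.
Qed.

End SeparableRegular.

(** Naturality of [eta] makes f a conjugate of G(F f); applying G to a generalized inverse of F f
    and conjugating back gives one for f. *)
Lemma equivalent_regular (K : fieldType) (C D : linear_category K) :
  equivalent C D -> von_neumann_regular D -> von_neumann_regular C.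
Proof.
case=> F [G [eta [_ [etaN _]]]] regD X Y f.
have [g gP] := regD _ _ (fmap F f).
have fE : f = eta Y \c fmap G (fmap F f) \c iso_bwd (eta X).
  by rewrite -etaN -compA iso_bwdK compm1.
exists (eta X \c fmap G g \c iso_bwd (eta Y)).
rewrite {1 2}fE -!compA [iso_bwd (eta X) \c _]compA iso_fwdK comp1m.
rewrite [iso_bwd (eta Y) \c _]compA iso_fwdK comp1m.
by rewrite !compA -2!(compA (eta Y)) -!fmap_comp gP -fE.
Qed.

(** * Linear categories *)

Section LinearCategoryTheory.
Variables (K : fieldType) (C : linear_category K).
Implicit Types X Y Z S : C.

Lemma compDl X Y Z (g h : hom Y Z) (f : hom X Y) :
  (g + h) \c f = g \c f + h \c f.
Proof. by have := comp_linl f 1 g h; rewrite !scale1r. Qed.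

Lemma compDr X Y Z (g : hom Y Z) (f h : hom X Y) :
  g \c (f + h) = g \c f + g \c h.
Proof. by have := comp_linr g 1 f h; rewrite !scale1r. Qed.

Lemma compNl X Y Z (g : hom Y Z) (f : hom X Y) : (- g) \c f = - (g \c f).
Proof. by apply/eqP; rewrite -addr_eq0 -compDl addNr comp_0l. Qed.

Lemma compNr X Y Z (g : hom Y Z) (f : hom X Y) : g \c (- f) = - (g \c f).
Proof. by apply/eqP; rewrite -addr_eq0 -compDr addNr comp_0r. Qed.

Lemma idm0_is_zero X : idm X = 0 -> is_zero X.
Proof.
move=> id0 Y; split=> f; first by rewrite -[f]compm1 id0 comp_0r.
by rewrite -[f]comp1m id0 comp_0l.
Qed.

Lemma mono0 X Y (f : hom X Y) :
  (forall Z (u : hom Z X), f \c u = 0 -> u = 0) -> mono f.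
Proof.
move=> f0 Z u v fuv; apply/eqP; rewrite -subr_eq0; apply/eqP/f0.
by rewrite compDr compNr fuv subrr.
Qed.

Lemma kernel_mono X Y Z (f : hom Y Z) (k : hom X Y) : is_kernel f k -> mono k.
Proof.
move=> [fk0 kP] T u v kuv.
have [|w [_ wP]] := kP T (k \c u); first by rewrite compA fk0 comp_0l.
by rewrite -(wP u) // -(wP v).
Qed.

Lemma cokernel_epi X Y Z (f : hom X Y) (c : hom Y Z) : is_cokernel f c -> epi c.
Proof.
move=> [cf0 cP] T u v ucv.
have [|w [_ wP]] := cP T (u \c c); first by rewrite -compA cf0 comp_0r.
by rewrite -(wP u) // -(wP v).
Qed.

Lemma iso_mono X Y (i : iso X Y) : mono i.
Proof.
move=> Z u v iuv.
by rewrite -[u]comp1m -[v]comp1m -(iso_fwdK i) -!compA iuv.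
Qed.

Lemma iso_epi X Y (i : iso X Y) : epi i.
Proof.
move=> Z u v iuv.
by rewrite -[u]compm1 -[v]compm1 -(iso_bwdK i) !compA iuv.
Qed.

Lemma isomorphic_refl X : isomorphic X X.
Proof. by split; exists (idm X) (idm X); rewrite comp1m. Qed.

Lemma split_mono X Y (f : hom X Y) (g : hom Y X) : g \c f = idm X -> mono f.
Proof.
by move=> gf Z u v fuv; rewrite -[u]comp1m -[v]comp1m -gf -!compA fuv. Qed.

Lemma split_epi X Y (f : hom X Y) (g : hom Y X) : f \c g = idm Y -> epi f.
Proof.
by move=> gf Z u v fuv; rewrite -[u]compm1 -[v]compm1 -gf !compA fuv. Qed.

Lemma direct_sum_iso X X' Y Y' Z Z' :
  isomorphic X X' -> isomorphic Y Y' -> isomorphic Z Z' ->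
  is_direct_sum X Y Z -> is_direct_sum X' Y' Z'.
Proof.
move=> [i] [j] [k] [i1 [i2 [p1 [p2 [p11 p22 p21 p12 sum1]]]]].
have E (A B D A' D' : C) (a : iso A A') (b : iso B Z') (d : iso D D')
    (p : hom B D) (q : hom A B) :
  (d \c p \c iso_bwd b) \c (b \c q \c iso_bwd a)
  = d \c (p \c q) \c iso_bwd a.
  by rewrite -!compA; do 2 congr comp; rewrite !compA iso_fwdK comp1m.
exists (k \c i1 \c iso_bwd i), (k \c i2 \c iso_bwd j),
       (i \c p1 \c iso_bwd k), (j \c p2 \c iso_bwd k); split.
- by rewrite E p11 compm1 iso_bwdK.
- by rewrite E p22 compm1 iso_bwdK.
- by rewrite E p21 comp_0r comp_0l.
- by rewrite E p12 comp_0r comp_0l.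
rewrite -!compA ![iso_bwd i \c _]compA ![iso_bwd j \c _]compA !iso_fwdK.
rewrite !comp1m !compA -(compA k i1) -(compA k i2) -compDl -compDr sum1 compm1.
exact: iso_bwdK.
Qed.

Lemma direct_sum0 X Z : is_zero Z -> is_direct_sum X Z X.
Proof.
move=> zZ; exists (idm X), 0, (idm X), 0; split; rewrite ?comp1m ?comp_0l //.
- by rewrite (proj1 (zZ Z) (idm Z)).
- by rewrite addr0.
Qed.

(** The kernel of [f] is a subobject of [S]: if it is all of [S] then f = 0, so it is zero. *)
Lemma simple_mono S Y (f : hom S Y) :
  is_abelian C -> simple S -> f != 0 -> mono f.
Proof.
move=> abC [_ subS] f0.
have [X [k kP]] := abelian_ker abC f.
have [zX | [i iE]] := subS _ _ (kernel_mono kP); last first.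
  case/eqP: f0; apply: (iso_epi (i := i)).
  by rewrite iE comp_0l; case: kP.
apply: mono0 => Z u fu0; have [v [<- _]] := (proj2 kP) _ _ fu0.
by rewrite (proj2 (zX _) v) comp_0r.
Qed.

Lemma schur S S' (f : hom S S') :
  is_abelian C -> simple S -> simple S' -> f != 0 -> is_iso f.
Proof.
move=> abC sS [_ subS'] f0.
have [zS|//] := subS' _ _ (simple_mono abC sS f0).
by case: sS.
Qed.

(** The complementary projection 1 - i h kills i, so it factors as u q through the cokernel, and u
    is the second inclusion. *)
Lemma extension_direct_sum Y X S (i : hom Y X) (q : hom X S) (h : hom X Y) :
  h \c i = idm Y -> is_cokernel i q -> is_direct_sum Y S X.
Proof.
move=> hi qP; have q_epi := cokernel_epi qP; case: qP => qi0 qP.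
have [|u [uq _]] := qP X (idm X - i \c h).
  by rewrite compDl compNl comp1m -compA hi compm1 subrr.
exists i, u, h, q; split=> //.
- apply: q_epi; rewrite -compA uq comp1m compDr compm1 compNr compA qi0 comp_0l.
  by rewrite subr0.
- apply: q_epi; rewrite -compA uq comp_0l compDr compm1 compNr compA hi comp1m.
  by rewrite subrr.
- by rewrite uq addrC subrK.
Qed.

End LinearCategoryTheory.

(** * Dimensions of Hom spaces *)

Section HomDimension.
Variables (K : fieldType) (C : linear_category K).
Hypothesis finC : is_finite C.
Implicit Types X Y Z S : C.

Definition hom_dim X Y : nat := xget 0%N [set n | has_dim (hom X Y) n]%classic.

Lemma hom_dimP X Y : has_dim (hom X Y) (hom_dim X Y).
Proof.
have [n [b bP]] := finite_hom finC X Y.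
have [|m mP] := @has_dim_exists K (hom X Y); first by exists n, b.
exact: (xgetPex 0%N (ex_intro _ m mP)).
Qed.

Lemma hom_dimE X Y n : has_dim (hom X Y) n -> hom_dim X Y = n.
Proof. by move/(has_dim_uniq (hom_dimP X Y)). Qed.

Lemma hom_dim_leq X Y X' Y' (g : hom X Y -> hom X' Y') :
  linear g -> injective g -> (hom_dim X Y <= hom_dim X' Y')%N.
Proof. exact: has_dim_leq (hom_dimP X Y) (hom_dimP X' Y'). Qed.

Lemma hom_dim_isor X Y Y' : isomorphic Y Y' -> hom_dim X Y = hom_dim X Y'.
Proof.
have le Z Z' : isomorphic Z Z' -> (hom_dim X Z <= hom_dim X Z')%N.
  move=> [i]; apply: (hom_dim_leq (g := fun f => i \c f)).
    exact: comp_linr.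
  by move=> u v /(iso_mono (i := i)).
by move=> YY'; apply/eqP; rewrite eqn_leq !le //; exact: isomorphic_sym.
Qed.

Lemma hom_dim_isol X X' Y : isomorphic X X' -> hom_dim X Y = hom_dim X' Y.
Proof.
have le Z Z' : isomorphic Z Z' -> (hom_dim Z' Y <= hom_dim Z Y)%N.
  move=> [i]; apply: (hom_dim_leq (g := fun f => f \c i)).
    exact: comp_linl.
  by move=> u v /(iso_epi (i := i)).
by move=> XX'; apply/eqP; rewrite eqn_leq !le //; exact: isomorphic_sym.
Qed.

Lemma hom_dim0r S X : is_zero X -> hom_dim S X = 0%N.
Proof. by move=> zX; apply/hom_dimE/has_dim0; case: (zX S). Qed.

Lemma hom_dim0l X S : is_zero X -> hom_dim X S = 0%N.
Proof. by move=> zX; apply/hom_dimE/has_dim0; case: (zX S). Qed.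

Lemma hom_dim_sumr S X Y Z :
  is_direct_sum X Y Z -> hom_dim S Z = (hom_dim S X + hom_dim S Y)%N.
Proof.
move=> [i1 [i2 [p1 [p2 [p11 p22 p21 p12 sum1]]]]]; apply: hom_dimE.
apply: (has_dim_prod (f := fun v w => i1 \c v + i2 \c w));
  [|exists (fun u => (p1 \c u, p2 \c u)); split|exact: hom_dimP..] => /=.
- by move=> a v v' w w'; rewrite !comp_linr scalerDr addrACA.
- by move=> u; rewrite /= !compA -compDl sum1 comp1m.
- case=> v w; rewrite /= !compDr !compA p11 p22 p12 p21 !comp_0l !comp1m.
  by rewrite addr0 add0r.
Qed.

Lemma hom_dim_suml S X Y Z :
  is_direct_sum X Y Z -> hom_dim Z S = (hom_dim X S + hom_dim Y S)%N.
Proof.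
move=> [i1 [i2 [p1 [p2 [p11 p22 p21 p12 sum1]]]]]; apply: hom_dimE.
apply: (has_dim_prod (f := fun v w => v \c p1 + w \c p2));
  [|exists (fun u => (u \c i1, u \c i2)); split|exact: hom_dimP..] => /=.
- by move=> a v v' w w'; rewrite !comp_linl scalerDr addrACA.
- by move=> u; rewrite /= -!compA -compDr sum1 compm1.
- case=> v w; rewrite /= !compDl -!compA p11 p22 p12 p21 !comp_0r !compm1.
  by rewrite addr0 add0r.
Qed.

Lemma hom_dim_neq0 X Y (f : hom X Y) : f != 0 -> (0 < hom_dim X Y)%N.
Proof.
move=> f0; rewrite lt0n; apply/negP => /eqP d0.
have [g [lg [h hK gK]]] := hom_dimP X Y; move: g lg h hK gK; rewrite d0.
move=> g _ h _ gK; case/eqP: f0; rewrite -[f]gK -[0]gK; congr g.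
by apply/rowP; case.
Qed.

Lemma hom_dim_gt0 X Y : (0 < hom_dim X Y)%N -> exists f : hom X Y, f != 0.
Proof.
move=> d0; apply: contrapT => no.
have f0 (f : hom X Y) : f = 0.
  by apply: contrapT => f0; apply: no; exists f; apply/eqP.
by rewrite (hom_dimE (has_dim0 f0)) in d0.
Qed.

End HomDimension.

(** * Tensor products and duality *)

Section TensorTheory.
Variables (K : fieldType) (C : fusion_category K).
Let T := fusion_mon C.
Implicit Types X Y Z D : C.
Local Notation "X ** Y" := (tens T X Y) (at level 38).
Local Notation "f ## g" := (tensm T f g) (at level 38).
Local Notation "1" := (unit_obj T).
Local Notation as_ := (assoc T).
Local Notation lu := (lunit T).
Local Notation ru := (runit T).

Lemma fusion_abelian : is_abelian C.
Proof. by case: (fusion_sep C). Qed.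

Lemma fusion_finite : is_finite C.
Proof. by case: (fusion_sep C). Qed.

Lemma fusion_regular : von_neumann_regular C.
Proof.
have [_ _ [A [sepA eqA]]] := fusion_sep C.
exact/(equivalent_regular eqA)/module_category_regular.
Qed.

Lemma tensm_linearl X X' Y Y' (g : hom Y Y') :
  linear (fun f : hom X X' => f ## g).
Proof. by have [lin _] := fusion_bilinear (f := C) X X' Y Y'; exact: lin. Qed.

Lemma tensm_linearr X X' Y Y' (f : hom X X') :
  linear (fun g : hom Y Y' => f ## g).
Proof. by have [_ lin] := fusion_bilinear (f := C) X X' Y Y'; exact: lin. Qed.

Lemma tensmDl X X' Y Y' (f f' : hom X X') (g : hom Y Y') :
  (f + f') ## g = f ## g + f' ## g.
Proof. by have := tensm_linearl g 1%R f f'; rewrite !scale1r. Qed.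

Lemma tensmDr X X' Y Y' (f : hom X X') (g g' : hom Y Y') :
  f ## (g + g') = f ## g + f ## g'.
Proof. by have := tensm_linearr f 1%R g g'; rewrite !scale1r. Qed.

Lemma tensm0l X X' Y Y' (g : hom Y Y') : (0 : hom X X') ## g = 0.
Proof. by apply: (addIr ((0 : hom X X') ## g)); rewrite -tensmDl !add0r. Qed.

Lemma tensm0r X X' Y Y' (f : hom X X') : f ## (0 : hom Y Y') = 0.
Proof. by apply: (addIr (f ## (0 : hom Y Y'))); rewrite -tensmDr !add0r. Qed.

Lemma tens_zerol X Y : is_zero X -> is_zero (X ** Y).
Proof.
move=> zX; apply: idm0_is_zero.
by rewrite -tensm_id ((zX X).1 (idm X)) tensm0l.
Qed.

Lemma tens_zeror X Y : is_zero Y -> is_zero (X ** Y).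
Proof.
move=> zY; apply: idm0_is_zero.
by rewrite -tensm_id ((zY Y).1 (idm Y)) tensm0r.
Qed.

Lemma tens_iso_fwdK X X' Y Y' (i : iso X X') (j : iso Y Y') :
  (iso_bwd i ## iso_bwd j) \c (i ## j) = idm (X ** Y).
Proof. by rewrite -tensm_comp !iso_fwdK tensm_id. Qed.

Lemma tens_iso_bwdK X X' Y Y' (i : iso X X') (j : iso Y Y') :
  (i ## j) \c (iso_bwd i ## iso_bwd j) = idm (X' ** Y').
Proof. by rewrite -tensm_comp !iso_bwdK tensm_id. Qed.

Definition tens_iso X X' Y Y' (i : iso X X') (j : iso Y Y') :
  iso (X ** Y) (X' ** Y') := Iso (tens_iso_fwdK i j) (tens_iso_bwdK i j).

Lemma tens_isomorphic X X' Y Y' :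
  isomorphic X X' -> isomorphic Y Y' -> isomorphic (X ** Y) (X' ** Y').
Proof. by move=> [i] [j]; split; exact: tens_iso. Qed.

Lemma tens_direct_suml X X' Z Y :
  is_direct_sum X X' Z -> is_direct_sum (X ** Y) (X' ** Y) (Z ** Y).
Proof.
move=> [i1 [i2 [p1 [p2 [p11 p22 p21 p12 sum1]]]]].
exists (i1 ## idm Y), (i2 ## idm Y), (p1 ## idm Y), (p2 ## idm Y).
rewrite -!tensm_comp -tensmDl !comp1m p11 p22 p21 p12 sum1 !tensm0l.
by split; rewrite ?tensm_id.
Qed.

Lemma tens_direct_sumr X Y Y' Z :
  is_direct_sum Y Y' Z -> is_direct_sum (X ** Y) (X ** Y') (X ** Z).
Proof.
move=> [i1 [i2 [p1 [p2 [p11 p22 p21 p12 sum1]]]]].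
exists (idm X ## i1), (idm X ## i2), (idm X ## p1), (idm X ## p2).
rewrite -!tensm_comp -tensmDr !comp1m p11 p22 p21 p12 sum1 !tensm0r.
by split; rewrite ?tensm_id.
Qed.

Lemma unit_tens_inj X Y (f g : hom X Y) : idm 1 ## f = idm 1 ## g -> f = g.
Proof.
move=> fg; apply: (iso_epi (i := lu X)).
by rewrite -!lunit_nat fg.
Qed.

Lemma tensm_swap X X' Y Y' (f : hom X X') (g : hom Y Y') :
  (f ## idm Y') \c (idm X ## g) = (idm X' ## g) \c (f ## idm Y).
Proof. by rewrite -!tensm_comp !comp1m !compm1. Qed.

Lemma assoc_nat_inv X X' Y Y' Z Z'
    (f : hom X X') (g : hom Y Y') (h : hom Z Z') :
  iso_bwd (as_ X' Y' Z') \c (f ## (g ## h))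
  = ((f ## g) ## h) \c iso_bwd (as_ X Y Z).
Proof.
apply: (iso_epi (i := as_ X Y Z)).
by rewrite -!compA iso_fwdK compm1 -assoc_nat compA iso_fwdK comp1m.
Qed.

(** * Dual objects *)

Section Duality.
Variables (D X : C) (ev : hom (D ** X) 1) (coev : hom 1 (X ** D)).
Hypothesis zigzag : ru X \c (idm X ## ev) \c as_ X D X
  \c (coev ## idm X) \c iso_bwd (lu X) = idm X.
Hypothesis zagzig : lu D \c (ev ## idm D) \c iso_bwd (as_ D X D)
  \c (idm D ## coev) \c iso_bwd (ru D) = idm D.

Let zigzagE : ru X \c (idm X ## ev) \c as_ X D X \c (coev ## idm X) = lu X.
Proof.
have := congr1 (fun h => h \c lu X) zigzag; rewrite /= comp1m => <-.
by rewrite -[RHS]compA iso_fwdK compm1.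
Qed.

Let zagzigE : (ev ## idm D) \c iso_bwd (as_ D X D) \c (idm D ## coev)
  = iso_bwd (lu D) \c ru D.
Proof.
have := congr1 (fun h => h \c ru D) zagzig; rewrite /= comp1m => <-.
by rewrite -[X in _ = _ \c X]compA iso_fwdK compm1 !compA iso_fwdK comp1m.
Qed.

(** The first zigzag identity tensored with [Z]: the pentagon and naturality of the associator
    collect all rebracketings into that identity, and the triangle absorbs the unit. *)
Let zigzag_tens Z :
  (idm X ## lu Z) \c (idm X ## (ev ## idm Z)) \c (idm X ## iso_bwd (as_ D X Z))
    \c as_ X D (X ** Z) \c (coev ## idm (X ** Z)) \c as_ 1 X Z
  = lu X ## idm Z.
Proof.
rewrite -[idm (X ** Z)]tensm_id -(compA _ _ (as_ 1 X Z)) -assoc_nat.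
rewrite !compA -(compA _ (as_ X D (X ** Z)) (as_ (X ** D) X Z)) pentagon.
rewrite !compA -(compA _ (idm X ## iso_bwd _)) -(tensm_comp T _ _ (iso_bwd _)).
rewrite iso_fwdK comp1m.
rewrite tensm_id compm1.
rewrite -(compA _ (idm X ## (ev ## idm Z))) -assoc_nat !compA triangle.
by rewrite -!tensm_comp !comp1m zigzagE.
Qed.

(** The second zigzag identity tensored with [Y], again rebracketed by the pentagon. *)
Let zagzig_tens Y :
  (ev ## idm (D ** Y)) \c iso_bwd (as_ D X (D ** Y)) \c (idm D ## as_ X D Y)
    \c (idm D ## (coev ## idm Y)) \c as_ D 1 Y
  = as_ 1 D Y \c ((iso_bwd (lu D) \c ru D) ## idm Y).
Proof.
have pent : (idm D ## as_ X D Y) \c as_ D (X ** D) Y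
  = as_ D X (D ** Y) \c as_ (D ** X) D Y \c (iso_bwd (as_ D X D) ## idm Y).
  rewrite pentagon -compA -tensm_comp iso_bwdK comp1m tensm_id compm1.
  by [].
rewrite -!compA -assoc_nat !compA.
rewrite -(compA _ (idm D ## as_ X D Y)) pent !compA.
rewrite -(compA _ _ (as_ D X (D ** Y))) iso_fwdK compm1.
rewrite -[idm (D ** Y)]tensm_id -assoc_nat -!compA -!tensm_comp !comp1m compA.
by rewrite zagzigE.
Qed.

(* Applying [X (x) -] to [phi f] gives back [1 (x) f] up to the split mono
   [theta]; as only dimensions matter, [theta] need not be identified further,
   and Kelly's coherence lemma for the unit is not required. *)
Lemma duality_leq Y Z :
  (hom_dim Y (X ** Z) <= hom_dim (D ** Y) Z)%N.
Proof.
pose phi (f : hom Y (X ** Z)) :=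
  lu Z \c (ev ## idm Z) \c iso_bwd (as_ D X Z) \c (idm D ## f).
apply: (hom_dim_leq fusion_finite (g := phi)) => [a f g | f g fg].
  by rewrite /phi tensm_linearr comp_linr.
pose theta := (idm X ## lu Z) \c (idm X ## (ev ## idm Z))
  \c (idm X ## iso_bwd (as_ D X Z)) \c as_ X D (X ** Z)
  \c (coev ## idm (X ** Z)).
have phiE h : theta \c (idm 1 ## h)
  = (idm X ## phi h) \c as_ X D Y \c (coev ## idm Y).
  rewrite /theta -(compA _ (coev ## _)) tensm_swap !compA.
  rewrite -(compA _ (as_ X D (X ** Z))) -[idm (X ** D)]tensm_id.
  rewrite assoc_nat !compA.
  by rewrite -!tensm_comp !comp1m.
apply/unit_tens_inj/(split_mono (f := theta)
  (g := as_ 1 X Z \c (iso_bwd (lu X) ## idm Z))).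
  have := zigzag_tens Z; rewrite -/theta => tE.
  have -> : theta = (lu X ## idm Z) \c iso_bwd (as_ 1 X Z).
    by rewrite -tE -compA iso_bwdK compm1.
  rewrite -compA [(iso_bwd _ ## _) \c _]compA -tensm_comp iso_fwdK comp1m.
  by rewrite tensm_id comp1m iso_bwdK.
by rewrite !phiE fg.
Qed.

(** Mirror image of [duality_leq]: [psi g] determines the composite of 1 (x) g with [theta], and
    [theta] is a split epimorphism by [zagzig_tens]. *)
Lemma duality_geq Y Z :
  (hom_dim (D ** Y) Z <= hom_dim Y (X ** Z))%N.
Proof.
pose psi (g : hom (D ** Y) Z) :=
  (idm X ## g) \c as_ X D Y \c (coev ## idm Y) \c iso_bwd (lu Y).
apply: (hom_dim_leq fusion_finite (g := psi)) => [a f g | f g fg].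
  by rewrite /psi tensm_linearr !comp_linl.
pose theta := (ev ## idm (D ** Y)) \c iso_bwd (as_ D X (D ** Y))
  \c (idm D ## as_ X D Y) \c (idm D ## (coev ## idm Y)).
have psiE h : (idm 1 ## h) \c theta
  = (ev ## idm Z) \c iso_bwd (as_ D X Z) \c (idm D ## (psi h \c lu Y)).
  rewrite /theta /psi -(compA _ (iso_bwd (lu Y))) iso_fwdK compm1 !compA.
  rewrite -tensm_swap.
  rewrite -(tensm_id T D X) -(compA _ _ (iso_bwd _)) -assoc_nat_inv -!compA.
  by rewrite -!tensm_comp !comp1m compA.
apply/unit_tens_inj/(split_epi (f := theta)
  (g := as_ D 1 Y \c ((iso_bwd (ru D) \c lu D) ## idm Y)
     \c iso_bwd (as_ 1 D Y))).
  rewrite !compA; have := zagzig_tens Y; rewrite -/theta => ->.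
  rewrite -(compA (as_ 1 D Y)) -tensm_comp comp1m compA -(compA (iso_bwd _)).
  by rewrite iso_bwdK compm1 iso_fwdK tensm_id compm1 iso_bwdK.
by rewrite !psiE fg.
Qed.

Lemma duality_hom_dim Y Z : hom_dim Y (X ** Z) = hom_dim (D ** Y) Z.
Proof. by apply/eqP; rewrite eqn_leq duality_leq duality_geq. Qed.

Hypothesis X0 : ~ is_zero X.

(** If ev g vanished for a generalized inverse g, then ev = ev g ev would vanish, and the zigzag
    would make [X] zero. So ev g is a nonzero endomorphism of the simple unit, invertible by Schur's
    lemma. *)
Lemma ev_split : exists h, ev \c h = idm 1.
Proof.
have [g gP] := fusion_regular ev.
have ev0 : ev \c g != 0.
  apply/eqP => eg0; apply/X0/idm0_is_zero.
  by rewrite -zigzag -gP eg0 comp_0l tensm0r comp_0r !comp_0l.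
have [i iE] := schur fusion_abelian (fusion_unit C) (fusion_unit C) ev0.
by exists (g \c iso_bwd i); rewrite compA -iE iso_bwdK.
Qed.

Lemma coev_split : exists h, h \c coev = idm 1.
Proof.
have [g gP] := fusion_regular coev.
have coev0 : g \c coev != 0.
  apply/eqP => gc0; apply/X0/idm0_is_zero.
  by rewrite -zigzag -gP -(compA coev) gc0 comp_0r tensm0l comp_0r comp_0l.
have [i iE] := schur fusion_abelian (fusion_unit C) (fusion_unit C) coev0.
by exists (iso_bwd i \c g); rewrite -compA -iE iso_fwdK.
Qed.

(** The unit is a retract of X (x) D through [coev]; tensor this with [Y]. *)
Lemma retract_dual_left Y :
  exists (s : hom Y (X ** (D ** Y))) p, p \c s = idm Y.
Proof.
have [h hP] := coev_split.
exists (as_ X D Y \c (coev ## idm Y) \c iso_bwd (lu Y)),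
       (lu Y \c (h ## idm Y) \c iso_bwd (as_ X D Y)).
rewrite -!compA [iso_bwd _ \c _]compA iso_fwdK comp1m.
by rewrite [(h ## _) \c _]compA -tensm_comp hP comp1m tensm_id comp1m iso_bwdK.
Qed.

Lemma retract_dual_right Y :
  exists (s : hom Y (Y ** (D ** X))) p, p \c s = idm Y.
Proof.
have [h hP] := ev_split.
exists ((idm Y ## h) \c iso_bwd (ru Y)), (ru Y \c (idm Y ## ev)).
rewrite -!compA [(_ ## ev) \c _]compA -tensm_comp hP comp1m tensm_id comp1m.
by rewrite iso_bwdK.
Qed.

End Duality.
End TensorTheory.

(** * The fusion semiring *)

Section FusionClasses.
Variables (K : fieldType) (C : fusion_category K) (O : simple_classes C).
Let T := fusion_mon C.
Implicit Types (X Y Z : C) (i j k l : O).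
Local Notation S := (@simple_repr _ _ O).
Local Notation "X ** Y" := (tens T X Y) (at level 38).

Lemma simple_idm_neq0 X : simple X -> idm X != 0.
Proof. by case=> nz _; apply/eqP => /idm0_is_zero. Qed.

Definition simple_dim i := hom_dim (S i) (S i).

Lemma simple_dim_gt0 i : (0 < simple_dim i)%N.
Proof.
exact/(hom_dim_neq0 (fusion_finite C))/simple_idm_neq0/simple_reprP.
Qed.

Lemma simple_hom_dim i j : hom_dim (S i) (S j) = ((i == j) * simple_dim j)%N.
Proof.
have [<-|ij] := eqVneq; first by rewrite mul1n.
rewrite mul0n; apply/eqP; rewrite -leqn0 leqNgt; apply/negP.
move=> /(hom_dim_gt0 (fusion_finite C))[f f0].
have [u _] := schur (fusion_abelian C) (simple_reprP i) (simple_reprP j) f0.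
by case/eqP: ij; apply: simple_repr_inj; split.
Qed.

(** Multiplicities can be read off from maps out of a simple object as well as from maps into it.
    This two-sidedness makes classes unique and lets duality exchange the roles of X_j and X_k. *)
Lemma has_class_hom_dim X (a : fusion_module O nat) :
  has_class X a -> forall k,
  hom_dim (S k) X = (a k * simple_dim k)%N /\
  hom_dim X (S k) = (a k * simple_dim k)%N.
Proof.
have fin := fusion_finite C.
elim=> {X a} [X zX|i X Xi|X Y Z a b _ IHX _ IHY sumZ] k.
- by rewrite hom_dim0r // hom_dim0l // ffunE mul0n.
- rewrite (hom_dim_isor fin _ Xi) (hom_dim_isol fin _ Xi) !simple_hom_dim ffunE.
  by rewrite (eq_sym k i); case: eqVneq => [->|].
- have [Xl Xr] := IHX k; have [Yl Yr] := IHY k.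
  rewrite (hom_dim_sumr fin _ sumZ) (hom_dim_suml fin _ sumZ) Xl Xr Yl Yr.
  by rewrite ffunE mulnDl.
Qed.

Lemma has_class_uniq X (a b : fusion_module O nat) :
  has_class X a -> has_class X b -> a = b.
Proof.
move=> /has_class_hom_dim aP /has_class_hom_dim bP; apply/ffunP => k.
apply/eqP; rewrite -(eqn_pmul2r (simple_dim_gt0 k)); apply/eqP.
by rewrite -(proj1 (aP k)) (proj1 (bP k)).
Qed.

Lemma has_class_exists X : exists a : fusion_module O nat, has_class X a.
Proof.
elim: (finite_obj (fusion_finite C) X) => {X} [X zX|].
  by exists 0; exact: HasClassZero.
move=> Y X Sm i q _ [a aP] i_mono qP smS.
(* Regularity splits each step of the composition series. *)
have [h ihi] := fusion_regular i.
have hi : h \c i = idm Y by apply: i_mono; rewrite compA ihi compm1.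
have [j Sj] := simple_repr_surj O smS.
exists (a + basis_elt nat j).
exact: HasClassSum aP (HasClassSimple Sj) (extension_direct_sum hi qP).
Qed.

Lemma obj_classP X : has_class X (obj_class O X).
Proof.
by have [a aP] := has_class_exists X; exact: (xgetPex 0 (ex_intro _ a aP)).
Qed.

Lemma obj_classE X (a : fusion_module O nat) :
  has_class X a -> obj_class O X = a.
Proof. exact/has_class_uniq/obj_classP. Qed.

Lemma obj_class_simple i : obj_class O (S i) = basis_elt nat i.
Proof. exact/obj_classE/HasClassSimple/isomorphic_refl. Qed.

(** [Y] is also a direct sum of [X] and a zero object, so the constructor for sums transports the
    class. *)
Lemma has_class_iso X Y (a : fusion_module O nat) :
  isomorphic X Y -> has_class X a -> has_class Y a.
Proof.
move=> XY aP; have [Z zZ] := abelian_zero (fusion_abelian C).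
rewrite -[a]addr0; apply: HasClassSum aP (HasClassZero O zZ) _.
by apply: direct_sum_iso (direct_sum0 X zZ) => //; exact: isomorphic_refl.
Qed.

Lemma obj_class_iso X Y : isomorphic X Y -> obj_class O X = obj_class O Y.
Proof.
move=> XY.
exact/obj_classE/(has_class_iso (isomorphic_sym XY))/obj_classP.
Qed.

Lemma obj_class_hom_diml X k :
  hom_dim (S k) X = (obj_class O X k * simple_dim k)%N.
Proof. by have [] := has_class_hom_dim (obj_classP X) k. Qed.

Lemma obj_class_hom_dimr X k :
  hom_dim X (S k) = (obj_class O X k * simple_dim k)%N.
Proof. by have [] := has_class_hom_dim (obj_classP X) k. Qed.

Definition fusion_coef i j k : nat := obj_class O (S i ** S j) k.

Section FusionMul.
Variable A : nzSemiRingType.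
Implicit Types a b c : fusion_module O A.

Lemma fusion_mulE a b k :
  fusion_mul a b k = \sum_i \sum_j a i * b j * (fusion_coef i j k)%:R.
Proof. by rewrite ffunE. Qed.

Lemma fusion_mul_basisl i b k :
  fusion_mul (basis_elt A i) b k = \sum_j b j * (fusion_coef i j k)%:R.
Proof.
rewrite fusion_mulE (bigD1 i) //= [X in _ + X]big1 ?addr0 => [|l /negPf li].
  by apply: eq_bigr => j _; rewrite ffunE eqxx mul1r.
by rewrite big1 // => j _; rewrite ffunE eq_sym li !mul0r.
Qed.

Lemma fusion_mul_basisr a j k :
  fusion_mul a (basis_elt A j) k = \sum_i a i * (fusion_coef i j k)%:R.
Proof.
rewrite fusion_mulE; apply: eq_bigr => i _.
rewrite (bigD1 j) //= big1 ?addr0 => [|l /negPf lj].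
  by rewrite ffunE eqxx mulr1.
by rewrite ffunE eq_sym lj mulr0 mul0r.
Qed.

Lemma fusion_mulDl a a' b :
  fusion_mul (a + a') b = fusion_mul a b + fusion_mul a' b.
Proof.
apply/ffunP => k; rewrite [RHS]ffunE !fusion_mulE -big_split.
apply: eq_bigr => i _.
rewrite -big_split; apply: eq_bigr => j _.
by rewrite ffunE !mulrDl.
Qed.

Lemma fusion_mulDr a b b' :
  fusion_mul a (b + b') = fusion_mul a b + fusion_mul a b'.
Proof.
apply/ffunP => k; rewrite [RHS]ffunE !fusion_mulE -big_split.
apply: eq_bigr => i _.
rewrite -big_split; apply: eq_bigr => j _.
by rewrite ffunE mulrDr !mulrDl.
Qed.

Lemma fusion_mul0l b : fusion_mul 0 b = 0.
Proof.
apply/ffunP => k; rewrite fusion_mulE ffunE big1 // => i _.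
by rewrite big1 // => j _; rewrite ffunE !mul0r.
Qed.

Lemma fusion_mul0r a : fusion_mul a 0 = 0.
Proof.
apply/ffunP => k; rewrite fusion_mulE ffunE big1 // => i _.
by rewrite big1 // => j _; rewrite ffunE mulr0 mul0r.
Qed.

End FusionMul.

Lemma fusion_mul_basis i j :
  fusion_mul (basis_elt nat i) (basis_elt nat j) = obj_class O (S i ** S j).
Proof.
apply/ffunP => k.
rewrite fusion_mul_basisl (bigD1 j) //= big1 => [|l /negPf lj].
  by rewrite addr0 ffunE eqxx mul1r natn.
by rewrite ffunE eq_sym lj mul0r.
Qed.

Lemma has_class_tens X Y (a b : fusion_module O nat) :
  has_class X a -> has_class Y b -> has_class (X ** Y) (fusion_mul a b).
Proof.
move=> aP; elim: aP Y b => {X a}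
  [X zX|i X Xi|X X' Z a a' _ IHX _ IHX' sumZ] Y b bP.
- by rewrite fusion_mul0l; apply/HasClassZero/tens_zerol.
- elim: bP => {Y b} [Y zY|j Y Yj|Y Y' Z b b' _ IHY _ IHY' sumZ].
  + by rewrite fusion_mul0r; apply/HasClassZero/tens_zeror.
  + rewrite fusion_mul_basis.
    apply: has_class_iso (obj_classP _).
    exact/isomorphic_sym/tens_isomorphic.
  + rewrite fusion_mulDr; apply: HasClassSum IHY IHY' _.
    exact: tens_direct_sumr.
- rewrite fusion_mulDl; apply: HasClassSum (IHX _ _ bP) (IHX' _ _ bP) _.
  exact: tens_direct_suml.
Qed.

Lemma obj_class_tens X Y :
  obj_class O (X ** Y) = fusion_mul (obj_class O X) (obj_class O Y).
Proof. by apply/obj_classE/has_class_tens; exact: obj_classP. Qed.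

(** Both sides are the multiplicity of X_k in a triple tensor product, bracketed in the two ways
    that the associator identifies. *)
Lemma fusion_coef_assoc i j l k :
  (\sum_m fusion_coef i j m * fusion_coef m l k
   = \sum_m fusion_coef j l m * fusion_coef i m k)%N.
Proof.
have /obj_class_iso : isomorphic ((S i ** S j) ** S l) (S i ** (S j ** S l)).
  by split; exact: (assoc T).
rewrite !obj_class_tens !obj_class_simple => /ffunP/(_ k).
rewrite fusion_mul_basisr fusion_mul_basisl !fusion_mul_basis.
rewrite -[LHS]/(\sum_m _)%N -[RHS]/(\sum_m _)%N.
have E F G : (\sum_m F m * (G m)%:R)%R = (\sum_(m : O) F m * G m)%N.
  by apply: eq_bigr => m _; rewrite natn.
by rewrite !E.
Qed.

Lemma fusion_mulA (A : comNzSemiRingType) (a b c : fusion_module O A) :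
  fusion_mul a (fusion_mul b c) = fusion_mul (fusion_mul a b) c.
Proof.
apply/ffunP => k; rewrite !fusion_mulE.
transitivity (\sum_i \sum_j \sum_l
    a i * b j * c l * (\sum_m fusion_coef j l m * fusion_coef i m k)%:R).
  apply: eq_bigr => i _.
  under eq_bigr => m _ do rewrite fusion_mulE mulr_sumr mulr_suml.
  rewrite exchange_big; apply: eq_bigr => j _.
  under eq_bigr => m _ do rewrite mulr_sumr mulr_suml.
  rewrite exchange_big; apply: eq_bigr => l _.
  rewrite natr_sum mulr_sumr; apply: eq_bigr => m _.
  by rewrite natrM !mulrA.
transitivity (\sum_i \sum_l \sum_j
    a i * b j * c l * (\sum_m fusion_coef i j m * fusion_coef m l k)%:R).
  apply: eq_bigr => i _; rewrite exchange_big; apply: eq_bigr => l _.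
  by apply: eq_bigr => j _; rewrite fusion_coef_assoc.
rewrite exchange_big [RHS]exchange_big; apply: eq_bigr => l _.
under [in RHS]eq_bigr => m _ do rewrite fusion_mulE -mulrA mulr_suml.
rewrite [RHS]exchange_big; apply: eq_bigr => i _.
under [in RHS]eq_bigr => m _ do rewrite mulr_suml.
rewrite [RHS]exchange_big; apply: eq_bigr => j _.
rewrite natr_sum mulr_sumr; apply: eq_bigr => m _.
by rewrite natrM mulrACA mulrAC -!mulrA; do 2 congr (_ * _); rewrite mulrCA.
Qed.

Lemma scal_ext_mul (A : comNzSemiRingType) (a b : fusion_module O nat) :
  scal_ext A (fusion_mul a b) = fusion_mul (scal_ext A a) (scal_ext A b).
Proof.
apply/ffunP => k; rewrite ffunE !fusion_mulE natr_sum; apply: eq_bigr => i _.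
rewrite natr_sum; apply: eq_bigr => j _.
by rewrite !ffunE natrM natn natrM.
Qed.

Lemma scal_ext_basis (A : comNzSemiRingType) i :
  scal_ext A (basis_elt nat i) = basis_elt A i.
Proof. by apply/ffunP => k; rewrite !ffunE natn. Qed.

Lemma obj_class_retract X k (s : hom (S k) X) p :
  p \c s = idm (S k) -> (0 < obj_class O X k)%N.
Proof.
move=> ps; have s0 : s != 0.
  apply: contra_eq_neq ps => ->; rewrite comp_0r eq_sym.
  exact/simple_idm_neq0/simple_reprP.
have := hom_dim_neq0 (fusion_finite C) s0.
by rewrite obj_class_hom_diml muln_gt0 => /andP[].
Qed.

(** X_k is a retract of X_i (x) (D (x) X_k), so it occurs in X_i (x) X_j for some constituent X_j of
    D (x) X_k. This is what makes the Perron matrix strictly positive. *)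
Lemma fusion_coef_transr i k : exists j, (0 < fusion_coef i j k)%N.
Proof.
have [[D [ev [coev [zig zag]]]] _] := fusion_rigid (f := C) (S i).
have [nz _] := simple_reprP i.
have [s [p ps]] := retract_dual_left zig nz (S k).
have := obj_class_retract ps; rewrite obj_class_tens obj_class_simple.
rewrite fusion_mul_basisl => /lt0n_neq0 sum0; apply: contrapT => no.
case/eqP: sum0; rewrite big1 // => j _.
have [->|] := posnP (fusion_coef i j k); first by rewrite mulr0.
by move=> ?; case: no; exists j.
Qed.

(** The same with the dual on the right: X_k is a retract of (X_k (x) D) (x) X_j. It serves for
    uniqueness of the regular element. *)
Lemma fusion_coef_transl j k : exists i, (0 < fusion_coef i j k)%N.
Proof.
have [[D [ev [coev [zig zag]]]] _] := fusion_rigid (f := C) (S j).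
have [nz _] := simple_reprP j.
have [s [p ps]] := retract_dual_right zig nz (S k).
have := obj_class_retract ps.
have /obj_class_iso <- : isomorphic ((S k ** D) ** S j) (S k ** (D ** S j)).
  by split; exact: (assoc T).
rewrite obj_class_tens obj_class_simple.
rewrite fusion_mul_basisr => /lt0n_neq0 sum0; apply: contrapT => no.
case/eqP: sum0; rewrite big1 // => i _.
have [->|] := posnP (fusion_coef i j k); first by rewrite mulr0.
by move=> ?; case: no; exists i.
Qed.

Lemma fusion_coef_dual i : exists D : C, forall j k,
  (fusion_coef i j k * simple_dim k
   = fusion_mul (obj_class O D) (basis_elt nat k) j * simple_dim j)%N.
Proof.
have [[D [ev [coev [zig zag]]]] _] := fusion_rigid (f := C) (S i).
exists D => j k.
rewrite -obj_class_hom_diml (duality_hom_dim zig zag) obj_class_hom_dimr.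
by rewrite obj_class_tens obj_class_simple.
Qed.

(** The class of the unit provides a starting index for maxima over [O] and a coordinate at which a
    positive vector is seen to be nonzero. *)
Lemma unit_class_index : O.
Proof.
have /cid[i _] := simple_repr_surj O (fusion_unit C).
exact: i.
Qed.

End FusionClasses.

(** * Perron eigenvectors *)

Lemma sum_continuous (R : realType) (T : topologicalType) (I : Type)
    (r : seq I) (f : I -> T -> R) :
  (forall i, continuous (f i)) -> continuous (fun x => \sum_(i <- r) f i x).
Proof.
move=> fc; elim: r => [|i r IH].
  have -> : (fun x => \sum_(i <- [::]) f i x) = (fun=> 0).
    by apply/funext => y; rewrite big_nil.
  exact: cst_continuous.
have -> : (fun x => \sum_(j <- i :: r) f j x)
  = (fun x => f i x + \sum_(j <- r) f j x).
  by apply/funext => y; rewrite big_cons.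
by move=> x; apply: cvgD; [exact: fc|exact: IH].
Qed.

Lemma sub_continuous (R : realType) (T : topologicalType) (f g : T -> R) :
  continuous f -> continuous g -> continuous (fun x => f x - g x).
Proof. by move=> fc gc x; apply: cvgB; [exact: fc|exact: gc]. Qed.

Lemma mul_continuous (R : realType) (T : topologicalType) (f g : T -> R) :
  continuous f -> continuous g -> continuous (fun x => f x * g x).
Proof. by move=> fc gc x; apply: cvgM; [exact: fc|exact: gc]. Qed.

Section Perron.
Variables (R : realType) (I : finType) (i0 : I).
Implicit Types (f v w : I -> R) (M : I -> I -> R).

(** Take e = min b / (1 + sum of |a k|); the summand 1 keeps the denominator positive. It supplies
    the increment of t in the Collatz-Wielandt argument. *)
Lemma exists_lower_bound (a b : I -> R) :
  (forall k, 0 < b k) -> exists2 e, 0 < e & forall k, e * a k <= b k.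
Proof.
move=> b0; pose m := [arg min_(k < i0) b k]%O.
have mP k : b m <= b k by rewrite /m; case: arg_minP => // i _; apply.
pose s := 1 + \sum_k `|a k|.
have s0 : 0 < s by rewrite ltr_pwDl // sumr_ge0.
exists (b m / s) => [|k]; first exact: divr_gt0.
apply: le_trans (mP k); rewrite -mulrA ler_piMr ?(ltW (b0 m)) //.
rewrite mulrC ler_pdivrMr // mul1r (le_trans (ler_norm _)) //.
rewrite /s (bigD1 k) //= addrCA lerDl addr_ge0 // sumr_ge0 //.
Qed.

(** With c the largest ratio f / v, the vector c v - f is nonnegative and vanishes at the maximizing
    index; all comparisons with a positive eigenvector start here. *)
Lemma exists_max_ratio f v : (forall k, 0 < v k) ->
  exists c k, f k = c * v k /\ forall l, f l <= c * v l.
Proof.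
move=> v0; pose k := [arg max_(k > i0) (f k / v k)]%O.
have kP l : f l / v l <= f k / v k.
  by rewrite /k; case: arg_maxP => // i _; apply.
exists (f k / v k), k; split; first by rewrite divfK // gt_eqF.
by move=> l; rewrite -ler_pdivrMr.
Qed.

Variable M : I -> I -> R.
Hypothesis M_gt0 : forall i k, 0 < M i k.

(** The box is compact by Tychonoff's theorem, and the remaining conditions are closed since they
    compare continuous functions of finitely many coordinates. *)
Let compact_pairs (B : R) :
  compact [set f : prod_topology (fun _ : option I => R) |
     (forall i, 0 <= f i <= B) /\ \sum_i f (Some i) = 1 /\
     forall k, f None * f (Some k) <= \sum_i f (Some i) * M i k]%classic.
Proof.
pose U := prod_topology (fun _ : option I => R).
have projc (i : option I) : continuous (fun f : U => f i : R).
  exact: (@proj_continuous _ (fun _ : option I => R)).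
pose box := [set f : U | forall i : option I, `[0, B]%classic (f i)]%classic.
have box_compact : compact box.
  exact: (@tychonoff _ (fun _ : option I => R) (fun=> `[0, B]%classic)
            (fun=> @segment_compact R 0 B)).
pose sum1 := [set f : U | \sum_i f (Some i) = 1]%classic.
have sumc : continuous (fun f : U => \sum_i f (Some i) : R).
  by apply: sum_continuous => i; exact: projc.
have sum1_closed : closed sum1.
  rewrite (_ : sum1 = ((fun f : U => \sum_i f (Some i) : R)
                         @^-1` [set x | x = 1])%classic) //.
  apply: closed_comp; last exact: closed_eq.
  by move=> f _; exact: sumc.
pose sub := (\bigcap_(k in [set: I])
  [set f : U |
     (f None * f (Some k) <= \sum_i f (Some i) * M i k)%R])%classic.
have sub_closed : closed sub.
  apply: closed_bigI => k _.
  pose g (f : U) : R := \sum_i f (Some i) * M i k - f None * f (Some k).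
  rewrite (_ : mkset _ = (g @^-1` [set x | 0 <= x])%classic); last first.
    by apply/seteqP; split => f /=; rewrite /g subr_ge0.
  apply: closed_comp; last exact: closed_ge.
  suff gc : continuous g by move=> f _; exact: gc.
  apply: (sub_continuous (f := fun f : U => \sum_i f (Some i) * M i k : R)
                         (g := fun f : U => f None * f (Some k) : R)).
    apply: (sum_continuous (f := fun i (f : U) => f (Some i) * M i k : R)) => i.
    apply: (mul_continuous (f := fun f : U => f (Some i) : R)
                           (g := fun=> M i k)).
      exact: projc.
    exact: cst_continuous.
  by apply: (mul_continuous (f := fun f : U => f None : R)
                           (g := fun f : U => f (Some k) : R)); exact: projc.
apply: (subclosed_compact _ box_compact (A := _)); last first.
  by move=> f [fB _] i /=; rewrite in_itv /=; exact: fB.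
rewrite (_ : mkset _ = (box `&` (sum1 `&` sub))%classic).
  apply: closedI; last exact: closedI.
  apply: compact_closed box_compact.
  exact: (@hausdorff_product _ (fun _ : option I => R)
            (fun=> @norm_hausdorff _ R)).
apply/seteqP; split => f /=.
  case=> fB [f1 fs]; split=> [i|]; last by split=> // k _; exact: fs.
  by rewrite /= in_itv /=; exact: fB.
case=> fB [f1 fs]; split=> [i|]; first by have := fB i; rewrite /= in_itv /=.
by split=> // k; exact: fs.
Qed.

(* The Collatz-Wielandt argument: take the largest t such that v M >= t v for
   some v in the simplex; if v M - t v were nonzero, v M would allow a larger t.
   A pair (t, v) is encoded as a function on [option I], with t at [None]. *)
Theorem perron_eigenvector :
  exists (t : R) v, (forall k, 0 < v k) /\
    forall k, \sum_i v i * M i k = t * v k.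
Proof.
(* [B] bounds both kinds of coordinate: normalized entries are at most 1, and summing t u <= u M
   over all coordinates bounds t by the sum of the entries of [M]. *)
pose B : R := 1 + \sum_i \sum_k M i k.
have sM_ge0 : 0 <= \sum_i \sum_k M i k.
  by apply: sumr_ge0 => i _; apply: sumr_ge0 => k _; exact: ltW.
pose A := [set f : prod_topology (fun _ : option I => R) |
     (forall i, 0 <= f i <= B) /\ \sum_i f (Some i) = 1 /\
     forall k, f None * f (Some k) <= \sum_i f (Some i) * M i k]%classic.
have normalize (t : R) v : 0 <= t -> (forall k, 0 <= v k) ->
    0 < \sum_k v k -> (forall k, t * v k <= \sum_i v i * M i k) ->
    A (fun o => if o is Some k then v k / \sum_k v k else t).
  move=> t0 v0 s0 tv; pose s := \sum_k v k.
  pose u k := v k / s.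
  have u0 k : 0 <= u k by rewrite divr_ge0 // ltW.
  have u1 : \sum_k u k = 1 by rewrite -mulr_suml divff // gt_eqF.
  have u_le1 k : u k <= 1.
    by rewrite -u1 (bigD1 k) //= lerDl sumr_ge0.
  have tu k : t * u k <= \sum_i u i * M i k.
    have -> : \sum_i u i * M i k = (\sum_i v i * M i k) / s.
      by rewrite mulr_suml; apply: eq_bigr => i _; rewrite mulrAC.
    by rewrite mulrA ler_pM2r ?invr_gt0.
  split; last by split.
  case=> [k|] /=.
    rewrite u0 /= (le_trans (u_le1 k)) // lerDl //.
  rewrite t0 /= -[t]mulr1 -u1 mulr_sumr.
  apply: (le_trans (ler_sum _ (fun k _ => tu k))).
  rewrite exchange_big /= /B addrC; apply: ler_wpDr => //.
  apply: ler_sum => i _; apply: ler_sum => k _.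
  by rewrite ler_piMl // ltW.
have A0 : (A !=set0)%classic.
  eexists; apply: (normalize 0 (fun=> 1)) => //.
    by rewrite (bigD1 i0) //= ltr_pwDl // sumr_ge0.
  by move=> k; rewrite mul0r sumr_ge0 // => i _; rewrite mul1r ltW.
have [f /set_mem[fB [f1 fs]] fmax] : exists2 c, c \in A & forall g, g \in A ->
    (g None : R) <= c None.
  apply: (compact_EVT_max (f := fun f : prod_topology _ => f None : R) A0).
    exact: compact_pairs.
  apply: continuous_subspaceT.
  exact: (@proj_continuous _ (fun _ : option I => R)).
pose t := f None; pose v k := f (Some k).
have v0 k : 0 <= v k by have /andP[] := fB (Some k).
have t0 : 0 <= t by have /andP[] := fB None.
pose w k := \sum_i v i * M i k.
have w_gt0 k : 0 < w k.
  have [i vi] : exists i, 0 < v i.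
    apply: contrapT => no; have := oner_neq0 R.
    rewrite -f1 big1 ?eqxx // => i _.
    by apply: contrapT => /eqP vi; apply: no; exists i; rewrite lt0r vi v0.
  rewrite /w (bigD1 i) //= ltr_pwDl ?mulr_gt0 // sumr_ge0 // => j _.
  by rewrite mulr_ge0 // ltW.
have wE k : w k = t * v k.
  apply: contrapT => /eqP wk.
  have d_ge0 j : 0 <= w j - t * v j by rewrite subr_ge0; exact: fs.
  have dk : 0 < w k - t * v k by rewrite lt0r subr_eq0 wk d_ge0.
  (* This is w M - t w: a nonnegative nonzero vector times a positive matrix is positive everywhere,
     which leaves room for some e > 0 with w M >= (t + e) w. *)
  have gain j : 0 < \sum_i (w i - t * v i) * M i j.
    rewrite (bigD1 k) //= ltr_pwDl ?mulr_gt0 // sumr_ge0 // => i _.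
    by rewrite mulr_ge0 // ltW.
  have [e e0 eP] := exists_lower_bound w gain.
  suff /mem_set/fmax : A (fun o =>
      if o is Some k then w k / \sum_k w k else t + e).
    by rewrite /= gerDl leNgt e0.
  apply: normalize => [||| j]; first by rewrite addr_ge0 // ltW.
  - by move=> j; exact: ltW.
  - by rewrite (bigD1 k) //= ltr_pwDl // sumr_ge0 // => j _; exact: ltW.
  have -> : \sum_i w i * M i j
    = t * w j + \sum_i (w i - t * v i) * M i j.
    rewrite {2}/w mulr_sumr -big_split; apply: eq_bigr => i _ /=.
    by rewrite mulrBl mulrA addrC subrK.
  by rewrite mulrDl lerD2l.
exists t, v; split=> [k|k]; last exact: wE.
rewrite lt0r v0 andbT; apply/eqP => vk.
by have := w_gt0 k; rewrite wE vk mulr0 ltxx.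
Qed.

(* The difference of the maximal multiple of v and w is a nonnegative
   eigenvector with a zero coordinate, hence zero because M > 0. *)
Lemma perron_unique (t : R) v w :
  (forall k, 0 < v k) -> (forall k, \sum_i v i * M i k = t * v k) ->
  (forall k, \sum_i w i * M i k = t * w k) ->
  exists c, forall k, w k = c * v k.
Proof.
move=> v0 vE wE; have [c [k [wk wle]]] := exists_max_ratio w v0.
exists c => j; apply/eqP; rewrite eq_sym -subr_eq0; apply/eqP.
pose u i := c * v i - w i.
have u0 i : 0 <= u i by rewrite subr_ge0.
have : \sum_i u i * M i k = 0.
  transitivity (t * u k); last by rewrite /u wk subrr mulr0.
  rewrite /u mulrBr mulrCA -vE -wE mulr_sumr -sumrB.
  by apply: eq_bigr => i _; rewrite mulrBl mulrA.
move/eqP; rewrite psumr_eq0 => [/allP/(_ j)|i _]; last first.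
  by rewrite mulr_ge0 // ltW.
by rewrite mem_index_enum mulf_eq0 (gt_eqF (M_gt0 j k)) orbF => /(_ isT) /eqP.
Qed.

End Perron.

(** * The regular element *)

Section EndoDim.
Variables (K : fieldType) (C : fusion_category K).
Let T := fusion_mon C.
Implicit Type X : C.

Lemma left_embedding_linear X : linear (@left_embedding K C X).
Proof.
by move=> a e e'; rewrite /left_embedding tensm_linearl comp_linr comp_linl.
Qed.

Lemma left_embeddingM X (e e' : endo_field C) :
  left_embedding X (e \c e') = left_embedding X e \c left_embedding X e'.
Proof.
rewrite /left_embedding -!compA [iso_bwd _ \c _]compA iso_fwdK comp1m.
by rewrite -[in LHS](comp1m (idm X)) tensm_comp -!compA.
Qed.

Lemma left_embedding1 X : left_embedding X (idm (unit_obj T)) = idm X.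
Proof. by rewrite /left_embedding tensm_id compm1 iso_bwdK. Qed.

Lemma left_embeddingZ1 X (k : K) :
  left_embedding X (k *: idm (unit_obj T)) = k *: idm X.
Proof.
have lin0 := left_embedding_linear X; rewrite -(left_embedding1 X).
have e0 : left_embedding X (0 : endo_field C) = 0.
  by rewrite /left_embedding tensm0l comp_0r comp_0l.
by have := lin0 k (idm _) 0; rewrite !addr0 e0 addr0.
Qed.

(** E is a division ring by Schur's lemma, and a family spanning over K spans over E because K acts
    through the multiples of the identity of the unit. *)
Lemma endo_basis_exists X : exists n (b : 'I_n -> hom X X), is_endo_basis b.
Proof.
pose act (e : endo_field C) (f : hom X X) := left_embedding X e \c f.
apply: (@division_basis (endo_field C) (hom X X) act (idm (unit_obj T))
          (fun e e' => e \c e')).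
- move=> e e' f; rewrite /act -compDl; congr (_ \c _).
  by have := left_embedding_linear X 1 e e'; rewrite !scale1r.
- by move=> e f f'; rewrite /act compDr.
- by move=> f; rewrite /act left_embedding1 comp1m.
- by move=> e e' f; rewrite /act left_embeddingM compA.
- move=> e e0; have [i <-] := schur (fusion_abelian C) (fusion_unit C)
    (fusion_unit C) e0.
  by exists (iso_bwd i); rewrite iso_fwdK.
have [n [b bP]] := finite_hom (fusion_finite C) X X.
exists n, b => f; have [a ->] := bP f.
exists (fun j => a j *: idm (unit_obj T)).
apply: eq_bigr => j _; rewrite /act left_embeddingZ1.
by have := comp_linl (b j) (a j) (idm X) 0; rewrite addr0 comp_0l addr0 comp1m.
Qed.

Lemma hom_dim_endo X :
  hom_dim X X = (endo_dim X * hom_dim (unit_obj T) (unit_obj T))%N.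
Proof.
have /(xgetPex 0%N)[b bP] :
  exists n, [set n | exists b : 'I_n -> hom X X, is_endo_basis b]%classic n.
  by have [n [b bP]] := endo_basis_exists X; exists n, b.
apply/(hom_dimE (fusion_finite C)).
apply: (has_dim_tower (act := fun e f => left_embedding X e \c f) _ bP).
  by move=> f a e e'; rewrite left_embedding_linear comp_linl.
exact: hom_dimP (fusion_finite C) _ _.
Qed.

End EndoDim.

(** * Positive eigenvectors of left multiplication *)

Section RegularElement.
Variables (R : realType) (K : fieldType) (C : fusion_category K).
Variable O : simple_classes C.
Implicit Types (v w r : fusion_module O R) (a b : fusion_module O nat).
Implicit Types (i j k l : O).
Local Notation S := (@simple_repr _ _ O).
Local Notation e := (basis_elt nat).

Lemma fusion_mul_scalel a v k :
  fusion_mul (scal_ext R a) v k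
  = \sum_i (a i)%:R * fusion_mul (basis_elt R i) v k.
Proof.
rewrite fusion_mulE; apply: eq_bigr => i _; rewrite fusion_mul_basisl mulr_sumr.
by apply: eq_bigr => j _; rewrite !ffunE mulrA.
Qed.

Lemma fusion_mul_scaler v w t :
  fusion_mul v (fusion_scale t w) = fusion_scale t (fusion_mul v w).
Proof.
apply/ffunP => k; rewrite [RHS]ffunE !fusion_mulE mulr_sumr.
apply: eq_bigr => i _.
by rewrite mulr_sumr; apply: eq_bigr => j _; rewrite !ffunE mulrCA !mulrA.
Qed.

Lemma mulmx_lmult (u : 'rV[R]_#|O|) a (k : 'I_#|O|) :
  (u *m lmult_matrix R a) 0 k
  = fusion_mul (scal_ext R a) [ffun j => u 0 (enum_rank j)] (enum_val k).
Proof.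
rewrite mxE (reindex enum_rank) /=; last exact/onW_bij/enum_rank_bij.
rewrite fusion_mulE exchange_big; apply: eq_bigr => j _.
rewrite mxE enum_rankK fusion_mul_basisr mulr_sumr; apply: eq_bigr => i _.
by rewrite !ffunE mulrCA mulrA.
Qed.

(** Let a w = s w with s >= 0 and w nonzero, and let c be the largest ratio |w| / v, attained at k.
    As the structure constants are nonnegative, s c v_k = |(a w)_k| <= c (a v)_k = t c v_k, whence s
    <= t. *)
Lemma FPdim_eigenvector a v t : (forall k, 0 < v k) ->
  fusion_mul (scal_ext R a) v = fusion_scale t v -> FPdim R a = t.
Proof.
move=> v0 av; have i0 := unit_class_index O.
have fE k : fusion_mul (scal_ext R a) v k = t * v k by rewrite av ffunE.
have coef_ge0 i j k : 0 <= (a i)%:R * (fusion_coef i j k)%:R :> R.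
  by rewrite mulr_ge0 ?ler0n.
have t0 : 0 <= t.
  rewrite -(pmulr_lge0 _ (v0 i0)) -fE fusion_mulE.
  apply: sumr_ge0 => i _; apply: sumr_ge0 => j _.
  by rewrite ffunE mulrAC mulr_ge0 // ltW.
have t_eig : eigenvalue (lmult_matrix R a) t.
  apply/eigenvalueP; exists (\row_j v (enum_val j)).
    apply/rowP => k; rewrite mulmx_lmult !mxE -fE; congr (fusion_mul _ _ _).
    by apply/ffunP => j; rewrite ffunE mxE enum_rankK.
  apply/eqP => /rowP/(_ (enum_rank i0))/eqP; rewrite !mxE enum_rankK.
  by rewrite gt_eqF.
have t_max s : 0 <= s -> eigenvalue (lmult_matrix R a) s -> s <= t.
  move=> s0 /eigenvalueP[u uE u0].
  pose w : fusion_module O R := [ffun j => u 0 (enum_rank j)].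
  have wE k : fusion_mul (scal_ext R a) w k = s * w k.
    have := mulmx_lmult u a (enum_rank k).
    by rewrite enum_rankK -/w => <-; rewrite uE mxE ffunE.
  have [c [k [wk wle]]] := exists_max_ratio i0 (fun j => `|w j|) v0.
  (* Otherwise |w| <= c v <= 0, and the eigenvector would vanish. *)
  have c0 : 0 < c.
    rewrite ltNge; apply/negP => c0; case/eqP: u0; apply/rowP => j.
    apply/eqP; rewrite mxE -normr_le0; have := wle (enum_val j).
    rewrite ffunE enum_valK => /le_trans; apply.
    by rewrite mulr_le0_ge0 // ltW.
  rewrite -(ler_pM2r (mulr_gt0 c0 (v0 k))) -wk -{1}(ger0_norm s0) -normrM -wE.
  rewrite wk mulrCA -fE !fusion_mulE mulr_sumr.
  rewrite (le_trans (ler_norm_sum _ _ _)) //.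
  apply: ler_sum => i _; rewrite mulr_sumr (le_trans (ler_norm_sum _ _ _)) //.
  apply: ler_sum => j _; rewrite [w]lock [v]lock !ffunE -!lock.
  rewrite mulrAC normrM (ger0_norm (coef_ge0 _ _ _)).
  by rewrite [X in c * X]mulrAC mulrCA ler_wpM2l.
apply: xget_unique; first by split.
move=> s [s0 s_eig s_max]; apply/le_anti.
by rewrite t_max //= s_max.
Qed.

Lemma regular_element_exists : exists r, regular_element r.
Proof.
have i0 := unit_class_index O.
(* The matrix of right multiplication by [z], the sum of the simple classes, on row vectors. *)
pose M i k : R := \sum_j (fusion_coef i j k)%:R.
have M0 i k : 0 < M i k.
  have [j Nj] := fusion_coef_transr i k.
  by rewrite /M (bigD1 j) //= ltr_pwDl ?ltr0n // sumr_ge0.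
have [t [v [v0 vE]]] := perron_eigenvector i0 M0.
pose z : fusion_module O R := [ffun=> 1].
have zE w k : fusion_mul w z k = \sum_i w i * M i k.
  rewrite fusion_mulE; apply: eq_bigr => i _; rewrite mulr_sumr.
  by apply: eq_bigr => j _; rewrite ffunE mulr1.
pose r : fusion_module O R := [ffun k => v k].
have r0 k : 0 < r k by rewrite ffunE.
have rz : fusion_mul r z = fusion_scale t r.
  apply/ffunP => k; rewrite zE !ffunE -vE.
  by apply: eq_bigr => i _; rewrite ffunE.
exists r; split=> //.
  by apply/eqP => /ffunP/(_ i0)/eqP; rewrite [X in _ == X]ffunE gt_eqF.
(* By associativity a r is again an eigenvector of right multiplication by [z] for the same t, hence
   a multiple of r. *)
move=> a; pose w := fusion_mul (scal_ext R a) r.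
have wz : fusion_mul w z = fusion_scale t w.
  by rewrite /w -fusion_mulA rz fusion_mul_scaler.
have [k|k|c wE] := @perron_unique R O i0 M M0 t r w r0.
- by rewrite -zE rz ffunE.
- by rewrite -zE wz ffunE.
have aE : fusion_mul (scal_ext R a) r = fusion_scale c r.
  by apply/ffunP => k; rewrite -/w wE [RHS]ffunE.
by rewrite (FPdim_eigenvector r0 aE).
Qed.

(** Evaluate (a b) r = a (b r) on a regular element r, a positive eigenvector common to all left
    multiplications. *)
Lemma FPdimM a b : FPdim R (fusion_mul a b) = FPdim R a * FPdim R b.
Proof.
have [r [_ rE r0]] := regular_element_exists.
apply: (FPdim_eigenvector r0).
rewrite scal_ext_mul -fusion_mulA rE fusion_mul_scaler rE.
by apply/ffunP => k; rewrite !ffunE mulrA [FPdim _ b * _]mulrC.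
Qed.

Lemma FPdim_sum a : FPdim R a = \sum_i (a i)%:R * FPdim R (e i).
Proof.
have [r [_ rE r0]] := regular_element_exists.
apply: (FPdim_eigenvector r0); apply/ffunP => k.
rewrite fusion_mul_scalel ffunE mulr_suml; apply: eq_bigr => i _.
by rewrite -scal_ext_basis rE ffunE mulrA.
Qed.

Lemma FPdim_basis_gt0 i : 0 < FPdim R (e i).
Proof.
have [r [_ rE r0]] := regular_element_exists.
have [j Nj] := fusion_coef_transr i i.
have := congr1 (fun w : fusion_module O R => w i) (rE (e i)).
rewrite scal_ext_basis [RHS]ffunE fusion_mul_basisl => sumE.
rewrite -(pmulr_lgt0 _ (r0 i)) -sumE (bigD1 j) //= ltr_pwDl //.
  by rewrite mulr_gt0 ?ltr0n.
by rewrite sumr_ge0 // => l _; rewrite mulr_ge0 // ltW.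
Qed.

Lemma regular_element_scale c r :
  0 < c -> regular_element r -> regular_element (fusion_scale c r).
Proof.
move=> c0 [_ rE r0]; have cr0 k : 0 < fusion_scale c r k.
  by rewrite ffunE mulr_gt0.
split=> // [|a].
  apply/eqP => /ffunP/(_ (unit_class_index O))/eqP.
  by rewrite [X in _ == X]ffunE gt_eqF.
rewrite fusion_mul_scaler rE.
by apply/ffunP => k; rewrite !ffunE mulrCA.
Qed.

(** For the largest ratio c, the vector c r' - r is nonnegative, vanishes at some k, and is scaled
    by every left multiplication. For each l, an i such that X_k occurs in X_i (x) X_l forces its
    coordinate at l to vanish. *)
Lemma regular_element_unique r r' : regular_element r -> regular_element r' ->
  exists2 c, 0 < c & r = fusion_scale c r'.
Proof.
move=> [_ rE r0] [_ rE' r0'].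
have [c [k [rk rle]]] := exists_max_ratio (unit_class_index O) r r0'.
exists c; first by rewrite -(pmulr_lgt0 _ (r0' k)) -rk.
apply/ffunP => l; rewrite ffunE; apply/eqP; rewrite eq_sym -subr_eq0.
have [i Nl] := fusion_coef_transl l k.
have u0 j : 0 <= c * r' j - r j by rewrite subr_ge0.
have : \sum_j (c * r' j - r j) * (fusion_coef i j k)%:R = 0.
  transitivity (FPdim R (e i) * (c * r' k - r k)); last first.
    by rewrite rk subrr mulr0.
  rewrite mulrBr mulrCA.
  have E w :
    (forall a, fusion_mul (scal_ext R a) w = fusion_scale (FPdim R a) w) ->
    FPdim R (e i) * w k = \sum_j w j * (fusion_coef i j k)%:R.
    by move=> wE; rewrite -fusion_mul_basisl -(scal_ext_basis R) wE ffunE.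
  rewrite !E // mulr_sumr -sumrB.
  by apply: eq_bigr => j _; rewrite mulrBl mulrA.
move/eqP; rewrite psumr_eq0 => [/allP/(_ l)|j _]; last by rewrite mulr_ge0.
rewrite mem_index_enum mulf_eq0 pnatr_eq0 (gtn_eqF Nl) orbF.
exact.
Qed.

Definition regular_formula : fusion_module O R :=
  [ffun k => FPdim R (e k) / (endo_dim (S k))%:R].

Lemma endo_dim_gt0 i : (0 < endo_dim (S i))%N.
Proof.
have := simple_dim_gt0 i.
by rewrite /simple_dim hom_dim_endo muln_gt0 => /andP[].
Qed.

(** Each K-dimension is an E-dimension times dim_K E; that factor is nonzero, as it divides the
    positive [simple_dim i], and cancels. *)
Lemma fusion_coef_dual_endo i : exists D : C, forall j k,
  (fusion_coef i j k * endo_dim (S k)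
   = fusion_mul (obj_class O D) (e k) j * endo_dim (S j))%N.
Proof.
have [D DP] := fusion_coef_dual i; exists D => j k; apply/eqP.
have := simple_dim_gt0 i; rewrite /simple_dim hom_dim_endo muln_gt0.
case/andP=> _ /eqn_pmul2r <-.
by rewrite -!mulnA -!hom_dim_endo; apply/eqP; exact: DP.
Qed.

(* By duality the coefficient of [X_k] in [X_i] * regular_formula is
   FPdim([D] [X_k]) / dim End(X_k), where D is a left dual of [X_i]. *)
Lemma regular_formula_regular : regular_element regular_formula.
Proof.
have pos k : 0 < regular_formula k.
  by rewrite ffunE divr_gt0 ?FPdim_basis_gt0 // ltr0n endo_dim_gt0.
split=> //.
  apply/eqP => /ffunP/(_ (unit_class_index O))/eqP.
  by rewrite [X in _ == X]ffunE gt_eqF.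
have basisE i : fusion_mul (basis_elt R i) regular_formula
    = fusion_scale (FPdim R (e i)) regular_formula.
  have [D DP] := fusion_coef_dual_endo i.
  have E : fusion_mul (scal_ext R (e i)) regular_formula
    = fusion_scale (FPdim R (obj_class O D)) regular_formula.
    apply/ffunP => k; rewrite scal_ext_basis fusion_mul_basisl [RHS]ffunE.
    rewrite [in RHS]ffunE mulrA -FPdimM FPdim_sum mulr_suml.
    apply: eq_bigr => j _; rewrite ffunE.
    have nz l : (endo_dim (S l))%:R != 0 :> R.
      by rewrite pnatr_eq0 -lt0n endo_dim_gt0.
    (* Clearing the denominator at [k] makes N_ij^k dim End(X_k) appear, which [DP] trades for the
       coefficient of [X_j] in [D][X_k] times dim End(X_j). *)
    apply: (mulIf (nz k)); rewrite divfK // -mulrA -natrM DP natrM.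
    by rewrite mulrCA mulrC divfK // mulrC.
  by rewrite -scal_ext_basis (FPdim_eigenvector pos E) -E.
move=> a; apply/ffunP => k; rewrite fusion_mul_scalel FPdim_sum ffunE mulr_suml.
by apply: eq_bigr => i _; rewrite basisE ffunE mulrA.
Qed.

End RegularElement.

Theorem theorem3p19 (R : realType) (K : fieldType) (C : fusion_category K)
    (O : simple_classes C) (r : fusion_module O R) :
  regular_element r <->
  exists2 c : R, 0 < c &
    r = fusion_scale c
      (\sum_(X : O)
         fusion_scale (FPdim_obj O R (simple_repr X) / (endo_dim (simple_repr X))%:R)
                      (scal_ext R (obj_class O (simple_repr X)))).
Proof.
(* The class of a representative is a basis vector, so the sum has a single nonzero term at each
   coordinate. *)
set s := \sum_X _; have -> : s = regular_formula R O.
  apply/ffunP => k; rewrite sum_ffunE (bigD1 k) //= big1 ?addr0 => [|l lk].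
    by rewrite /FPdim_obj obj_class_simple !ffunE eqxx mulr1.
  by rewrite obj_class_simple !ffunE (negPf lk) mulr0.
split=> [rP | [c c0 ->]].
  exact: regular_element_unique (regular_formula_regular R O).
exact/regular_element_scale/regular_formula_regular.
Qed.
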